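(* Consider the golf process on $\mathbb{Z}$ with parameters $\rho_b=\rho_h$ and any $p\in[0,1]$. Then almost surely the set $H^1$ of holes still free at time $1$ is empty.
   Context: Golf process on $\mathbb{Z}$: initial states i.i.d., each vertex containing a ball with probability $\rho_b$, a hole with probability $\rho_h$, neutral otherwise ($\rho_b+\rho_h\le1$); clocks i.i.d. uniform on $[0,1]$; at its clock time each ball performs an independent random walk (step $+1$ w.p. $p$, $-1$ w.p. $1-p$) started at its vertex and stopped at the first currently free hole, which it fills. (This process is almost surely well defined and not frozen when $\rho_b\le\rho_h$.) *)

(* Defs.v *)
From HB Require Import structures.
From mathcomp Require Import all_boot all_order all_algebra.
From mathcomp Require Import all_classical all_reals all_analysis.
Set Implicit Arguments. Unset Strict Implicit. Unset Printing Implicit Defensive.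
Import Order.TTheory GRing.Theory Num.Theory.
Local Open Scope classical_set_scope.
Local Open Scope ring_scope.

Definition mutually_independent {d} {T : measurableType d} {R : realType}
    (P : probability T R) (I : eqType) (X : I -> T -> R) : Prop :=
  forall (J : seq I), uniq J ->
  forall (B : I -> set R), (forall j, measurable (B j)) ->
  P (\bigcap_(j in [set` J]) (X j @^-1` B j)) =
    (\prod_(j <- J) fine (P (X j @^-1` B j)))%:E.

(* Deterministic golf dynamics on Z, given the initial configuration,  *)
(* the clocks and the random-walk steps.                               *)
(*   ball b / hole h : site b contains a ball / site h contains a hole *)
(*   U b             : clock of site b                                 *)
(*   step b k        : k-th step of the walk of the ball started at b  *)
(*                     (true = +1, false = -1)                         *)
(*   tau b           : Some n if the ball started at b stops (fills a  *)
(*                     hole) after n steps, None if it never stops     *)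
(*                     (or if there is no ball at b).                  *)
Definition walk_pos (step : int -> nat -> bool) (b : int) (n : nat) : int :=
  b + \sum_(k < n) (if step b k then 1 else -1).

Definition filled_before {R : realType} (ball : int -> Prop) (U : int -> R)
    (step : int -> nat -> bool) (tau : int -> option nat) (h : int) (t : R) : Prop :=
  exists b m, ball b /\ U b < t /\ tau b = Some m /\ walk_pos step b m = h.

Definition free_at {R : realType} (ball hole : int -> Prop) (U : int -> R)
    (step : int -> nat -> bool) (tau : int -> option nat) (h : int) (t : R) : Prop :=
  hole h /\ ~ filled_before ball U step tau h t.

Definition golf_consistent {R : realType} (ball hole : int -> Prop) (U : int -> R)
    (step : int -> nat -> bool) (tau : int -> option nat) : Prop :=
  forall b,
    (ball b -> forall n, tau b = Some n <->
        (free_at ball hole U step tau (walk_pos step b n) (U b) /\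
         forall m, (m < n)%N -> ~ free_at ball hole U step tau (walk_pos step b m) (U b)))
    /\ (~ ball b -> tau b = None).

Definition free_at_time1 {R : realType} (ball hole : int -> Prop) (U : int -> R)
    (step : int -> nat -> bool) (tau : int -> option nat) (h : int) : Prop :=
  hole h /\ ~ (exists b m, ball b /\ U b <= 1 /\ tau b = Some m /\ walk_pos step b m = h).

(* Random input of the golf process.  The state of site i is encoded   *)
(* by the real random variable st i : 1 = ball, 2 = hole, 0 = neutral. *)
(* clk i is the clock of site i, stp i k in {+1,-1} is the k-th step   *)
(* of the walk attached to site i.                                     *)
Definition golf_index : eqType := ((int + int) + (int * nat))%type.

Definition golf_family {T : Type} {R : realType} (st clk : int -> T -> R)
    (stp : int -> nat -> T -> R) : golf_index -> T -> R :=
  fun j => match j with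
           | inl (inl i) => st i
           | inl (inr i) => clk i
           | inr (i, k) => stp i k
           end.

Definition golf_law {d} {T : measurableType d} {R : realType} (P : probability T R)
    (rho_b rho_h p : R) (st clk : int -> T -> R) (stp : int -> nat -> T -> R) : Prop :=
  (forall j, measurable_fun setT (golf_family st clk stp j)) /\
  (forall i, P [set w | st i w = 1] = rho_b%:E /\
             P [set w | st i w = 2] = rho_h%:E /\
             P [set w | st i w = 0] = (1 - rho_b - rho_h)%:E) /\
  (forall i (x : R), 0 <= x <= 1 -> P [set w | clk i w <= x] = x%:E) /\
  (forall i k, P [set w | stp i k w = 1] = p%:E /\
               P [set w | stp i k w = -1] = (1 - p)%:E) /\
  mutually_independent P (golf_family st clk stp).

Definition ball_of {T : Type} {R : realType} (st : int -> T -> R) (w : T) : int -> Prop :=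
  fun i => st i w = 1.
Definition hole_of {T : Type} {R : realType} (st : int -> T -> R) (w : T) : int -> Prop :=
  fun i => st i w = 2.
Definition clock_of {T : Type} {R : realType} (clk : int -> T -> R) (w : T) : int -> R :=
  fun i => clk i w.
Definition step_of {T : Type} {R : realType} (stp : int -> nat -> T -> R) (w : T) :
    int -> nat -> bool :=
  fun i k => stp i k w == 1.

(* Main.v *)
(** A box process, in which only the balls of a finite interval move, is deterministic and
    monotone: more balls fill more holes, and every consistent evolution on the line fills
    at least the holes filled in each box. Call a hole never filled at time t if it is free
    at time t in all boxes. No ball active before t crosses such a hole, so if [c, c + M)
    contains none of them, then some interval around it has at least as many active balls
    as holes; for t < 1 a Chernoff bound makes this exponentially unlikely in M. Hence the
    never filled holes at time t are unbounded on both sides, which confines each ball to a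
    finite interval and lets the box processes converge to a consistent evolution.
    Between two never filled holes the active balls inject into the filled holes, so by
    stationarity the density of holes never filled at time t is at most rho - rho t. A hole
    free at time 1 in a consistent evolution is never filled at every t < 1, and
    rho (1 - t) tends to 0. *)
Require Import Defs.
From HB Require Import structures.
From mathcomp Require Import all_boot all_order all_algebra.
From mathcomp Require Import all_classical all_reals all_analysis.
From mathcomp Require Import measurable_realfun zify ring lra.
Set Implicit Arguments. Unset Strict Implicit. Unset Printing Implicit Defensive.
Import Order.TTheory GRing.Theory Num.Theory numFieldNormedType.Exports.
Local Open Scope classical_set_scope.
Local Open Scope ring_scope.

(** * Deterministic dynamics *)

(** The conclusion concerns every consistent [tau], and such a [tau] comes with neither uniqueness
    nor measurability in the sample point. Box processes are finite iterations, hence measurable and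
    translation covariant, and they lie below every consistent evolution; so all probability
    estimates are made on boxes. Time 1 itself is out of reach of the deviation bound: active balls
    and holes then have equal density, the count in a window has no drift, and no exponential tilt
    brings the single-site factor below 1. For t < 1 the drift is rho (1 - t), hence the detour
    through times increasing to 1. The injection of balls into filled holes rests on two null-set
    facts. Clocks are pairwise distinct, since two balls with one clock could both see the same hole
    as free; and every walk leaves every bounded set, since otherwise an active ball between two
    barriers might never stop. The second fact is obtained from long runs of equal steps, which
    treats all p in [0,1] alike, the recurrent case included. *)

Definition first_hit (F : int -> Prop) (w : nat -> int) : option nat :=
  match pselect (exists n, `[<F (w n)>]) with
  | left e => Some (ex_minn e)
  | right _ => None
  end.

Lemma first_hitP (F : int -> Prop) (w : nat -> int) (n : nat) :
  first_hit F w = Some n <-> F (w n) /\ forall m, (m < n)%N -> ~ F (w m).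
Proof.
rewrite /first_hit; case: pselect => [e|ne]; last first.
  by split=> // -[Fn _]; exfalso; apply: ne; exists n; apply/asboolP.
case: ex_minnP => k /asboolP Fk kmin; split=> [[<-]|[Fn nF]].
  split=> // m mk Fm; have := kmin m; rewrite leqNgt mk => h.
  by have := h (asboolT Fm).
congr Some; apply/eqP; rewrite eqn_leq kmin ?asboolT //= leqNgt.
by apply/negP => /nF.
Qed.

Lemma first_hit_None (F : int -> Prop) (w : nat -> int) :
  first_hit F w = None -> forall n, ~ F (w n).
Proof.
rewrite /first_hit; case: pselect => // ne _ n Fn; apply: ne.
by exists n; apply/asboolP.
Qed.

Lemma eq_first_hit (F G : int -> Prop) (w : nat -> int) :
  (forall x, F x <-> G x) -> first_hit F w = first_hit G w.
Proof. by move=> FG; congr first_hit; apply/funext => x; apply/propext. Qed.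

Lemma walk_pos0 (step : int -> nat -> bool) (b : int) : walk_pos step b 0 = b.
Proof. by rewrite /walk_pos big_ord0 addr0. Qed.

Lemma walk_posS (step : int -> nat -> bool) (b : int) (n : nat) :
  walk_pos step b n.+1 = walk_pos step b n + (if step b n then 1 else -1).
Proof. by rewrite /walk_pos big_ord_recr /= addrA. Qed.

(** Discrete intermediate value property, from steps of size one. It is what turns a free hole into
    a barrier. *)
Lemma walk_pos_hits (step : int -> nat -> bool) (b x : int) (n : nat) :
  b <= x <= walk_pos step b n \/ walk_pos step b n <= x <= b ->
  exists2 m, (m <= n)%N & walk_pos step b m = x.
Proof.
elim: n => [|n IH] h.
  by exists 0%N => //; move: h; rewrite walk_pos0; lia.
have [E|E] := eqVneq (walk_pos step b n.+1) x; first by exists n.+1.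
have [|m mn <-] := IH; last by exists m => //; lia.
by move: h E; rewrite walk_posS; case: ifP => _; lia.
Qed.

Lemma count_lt (T : eqType) (a1 a2 : pred T) (s : seq T) (x : T) :
  (forall y, a1 y -> a2 y) -> x \in s -> a2 x -> ~~ a1 x ->
  (count a1 s < count a2 s)%N.
Proof.
move=> a12 xs a2x na1x; elim: s xs => // y s IH; rewrite inE => /predU1P[<-|xs] /=.
  by rewrite a2x (negbTE na1x) add0n add1n ltnS; apply: sub_count.
have := IH xs; have := a12 y; case: (a1 y) => [->//|_]; lia.
Qed.

(** The clock order on infinitely many sites can fail to be well-founded, so the induction is
    confined to a finite list and runs on the number of its entries with a smaller clock. *)
Lemma wf_clock_ind (I : eqType) (R : realType) (U : I -> R) (s : seq I) (Q : I -> Prop) :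
  (forall b, b \in s -> (forall b', b' \in s -> U b' < U b -> Q b') -> Q b) ->
  forall b, b \in s -> Q b.
Proof.
move=> H b; move: {2}(count _ _) (leqnn (count (fun c => U c < U b) s)) => k.
elim: k b => [|k IH] b hk bs; apply: H => // b' b's lt.
  suff : (0 < count (fun c => (U c < U b)%R) s)%N by lia.
  by rewrite -has_count; apply/hasP; exists b'.
apply: IH => //; rewrite -ltnS; apply: leq_trans hk.
apply: (@count_lt _ _ _ _ b') => //; last by rewrite ltxx.
by move=> y /lt_trans; apply.
Qed.

Section Dynamics.
Variables (R : realType) (hole : int -> Prop) (U : int -> R)
  (step : int -> nat -> bool).
Implicit Types (ball : int -> Prop) (tau : int -> option nat).

Let consistent ball tau := golf_consistent ball hole U step tau.
Let filled ball tau h (t : R) := filled_before ball U step tau h t.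
Let free ball tau h (t : R) := free_at ball hole U step tau h t.

Definition golf_next ball tau (b : int) : option nat :=
  if pselect (ball b) then first_hit (free ball tau ^~ (U b)) (walk_pos step b)
  else None.

Lemma golf_nextP ball tau : consistent ball tau <-> forall b, tau b = golf_next ball tau b.
Proof.
split=> [H b|H b].
  have [H1 H2] := H b; rewrite /golf_next; case: pselect => // bb.
  case E : first_hit => [n|].
    by apply/(H1 bb); move/first_hitP: E.
  case E' : (tau b) => [n|//].
  by move/(H1 bb)/(first_hitP (free ball tau ^~ (U b)) _ n).2: E'; rewrite E.
rewrite H /golf_next; case: pselect => // bb; split => // _ n.
exact: (first_hitP (free ball tau ^~ (U b))).
Qed.

Lemma filled_mono_time ball tau h (s t : R) : s <= t ->
  filled ball tau h s -> filled ball tau h t.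
Proof. by move=> st [b [m [bb [/lt_le_trans/(_ st) Ub tb]]]]; exists b, m. Qed.

Lemma free_anti_time ball tau h (s t : R) : s <= t ->
  free ball tau h t -> free ball tau h s.
Proof. by move=> st [hh nf]; split => // /(filled_mono_time st). Qed.

Lemma eq_golf_next ball tau1 tau2 (b : int) :
  (forall b', ball b' -> U b' < U b -> tau1 b' = tau2 b') ->
  golf_next ball tau1 b = golf_next ball tau2 b.
Proof.
move=> H; rewrite /golf_next; case: pselect => // bb; apply: eq_first_hit => x.
by split=> -[hx nf]; split => // -[b' [m [bb' [lt [E Ex]]]]]; apply: nf;
  exists b', m; do 3!split => //; rewrite -E H.
Qed.

Definition golf_iter ball (k : nat) : int -> option nat :=
  iter k (golf_next ball) (fun=> None).

(** [golf_next] at a site consults only balls with strictly smaller clocks, so the iterates at a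
    site are stable once their number exceeds the number of smaller clocks in [s]. A site of [s]
    does not precede itself, so [size s] rounds suffice. *)
Lemma golf_iter_consistent ball (s : seq int) : (forall b, ball b -> b \in s) ->
  consistent ball (golf_iter ball (size s)).
Proof.
move=> bs; apply/golf_nextP => b.
suff H k c : (count (fun c' => U c' < U c)%R s < k)%N ->
    golf_iter ball k c = golf_iter ball k.+1 c.
  have [bin|nbin] := boolP (b \in s).
    apply: (H (size s)); rewrite -(count_predT s).
    by apply: (@count_lt _ _ _ _ b) => //=; rewrite ltxx.
  have nb : ~ ball b by move/bs; rewrite (negbTE nbin).
  have N tau : golf_next ball tau b = None by rewrite /golf_next; case: pselect.
  by rewrite N; case: (size s) => [|k] //=; rewrite N.
elim: k c => // k IH c hk; apply: eq_golf_next => b' bb' lt; apply: IH.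
apply: (leq_trans _ (_ : count (fun c' => U c' < U c)%R s <= k)%N) => //.
apply: (@count_lt _ _ _ _ b') => //; last by rewrite ltxx.
- by move=> y /lt_trans; apply.
- exact: bs.
Qed.

(* Following one ball in both processes: at its clock time every hole that is free for [ball2]
   is free for [ball1], so its first [ball1]-free hole is no later than its [ball2]-stop. *)
Lemma filled_mono ball1 ball2 tau1 tau2 (s : seq int) :
  (forall b, ball1 b -> b \in s) -> (forall b, ball1 b -> ball2 b) ->
  consistent ball1 tau1 -> consistent ball2 tau2 ->
  forall h t, filled ball1 tau1 h t -> filled ball2 tau2 h t.
Proof.
move=> b1s b12 C1 C2.
(* The ball filling the hole in the larger system may differ from [b]; the induction retains only
   that its clock is no later. *)
suff H b : b \in s -> ball1 b -> forall m, tau1 b = Some m ->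
    exists b' m', [/\ ball2 b', U b' <= U b, tau2 b' = Some m' &
      walk_pos step b' m' = walk_pos step b m].
  move=> h t [b [m [bb [lt [E <-]]]]].
  have [b' [m' [? le ? ?]]] := H b (b1s _ bb) bb m E.
  by exists b', m'; split => //; split => //; apply: le_lt_trans lt.
move: b; apply: (wf_clock_ind (U := U)) => b bs IH bb m Em.
have f12 x : filled ball1 tau1 x (U b) -> filled ball2 tau2 x (U b).
  move=> [c [n [cc [lt [En <-]]]]].
  have [b' [m' [? le ? ?]]] := IH c (b1s _ cc) lt cc n En.
  by exists b', m'; split => //; split => //; apply: le_lt_trans lt.
have /(C1 b).1 [//|[hm nfm] minm] := Em.
have [C2s _] := C2 b; have {}C2s := C2s (b12 _ bb).
(* If the larger system has not filled this hole yet, [b] itself stops there: by [f12], sites that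
   were not free in the smaller system are not free in the larger one. *)
have [f2|nf2] := pselect (filled ball2 tau2 (walk_pos step b m) (U b)).
  move: f2 => [b' [m' [? [lt [? ?]]]]]; exists b', m'; split => //; exact: ltW.
exists b, m; split => //; first exact: b12.
apply/C2s; split => // k km [hk nk]; apply: (minm k km); split => //.
by move/f12.
Qed.

(** A walk that crosses [x] visits it. Since [x] is free at [s], it is free already at the clock
    time of [b], so the ball would stop there and fill [x] before [s]. *)
Lemma stop_same_side ball tau x (s : R) b m : consistent ball tau -> free ball tau x s ->
  ball b -> U b < s -> tau b = Some m ->
  (b < x /\ walk_pos step b m < x) \/ (x < b /\ x < walk_pos step b m).
Proof.
move=> C fx bb lt Em.
suff H : ~ (b <= x <= walk_pos step b m \/ walk_pos step b m <= x <= b) by lia.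
move=> /walk_pos_hits [k km Ek].
have /(C b).1 [//|_ minm] := Em.
move: km; rewrite leq_eqVlt => /predU1P[E|/minm]; last first.
  by apply; rewrite Ek; apply: free_anti_time fx; apply: ltW.
by apply: fx.2; exists b, m; rewrite -E Ek E.
Qed.

End Dynamics.

(** * Box processes *)

Definition zrange (a : int) (L : nat) : seq int := [seq a + k%:Z | k <- iota 0 L].

Lemma mem_zrange (a : int) (L : nat) (x : int) :
  (x \in zrange a L) = (a <= x < a + L%:Z).
Proof.
apply/mapP/idP => [[k]|h].
  by rewrite mem_iota => h ->; lia.
by exists `|x - a|%N; rewrite ?mem_iota; lia.
Qed.

Lemma zrange_uniq (a : int) (L : nat) : uniq (zrange a L).
Proof. by rewrite map_inj_uniq ?iota_uniq // => x y; lia. Qed.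

Lemma size_zrange (a : int) (L : nat) : size (zrange a L) = L.
Proof. by rewrite size_map size_iota. Qed.

Definition zcount (A : int -> Prop) (a : int) (L : nat) : nat :=
  count (fun x => `[<A x>]) (zrange a L).

(** Pigeonhole with a relation in place of a function, because the partners are only obtained
    existentially; choice selects them. *)
Lemma zcount_le_inj (A B : int -> Prop) (r : int -> int -> Prop) (a a' : int) (L L' : nat) :
  (forall x : int, a <= x < a + L%:Z -> A x ->
     exists y : int, [/\ a' <= y < a' + L'%:Z, B y & r x y]) ->
  (forall x x' y, A x -> A x' -> r x y -> r x' y -> x = x') ->
  (zcount A a L <= zcount B a' L')%N.
Proof.
move=> H rinj.
have /choice [f fP] : forall x : int, exists y : int, a <= x < a + L%:Z -> A x ->
    [/\ a' <= y < a' + L'%:Z, B y & r x y].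
  move=> x; have [|h] := pselect (a <= x < a + L%:Z /\ A x); last first.
    by exists 0 => h1 h2; exfalso; apply: h.
  by move=> [h1 h2]; have [y hy] := H x h1 h2; exists y.
rewrite /zcount -!size_filter -(size_map f); apply: uniq_leq_size.
  rewrite map_inj_in_uniq ?filter_uniq ?zrange_uniq // => x x'.
  rewrite !mem_filter !mem_zrange => /andP[/asboolP Ax hx] /andP[/asboolP Ax' hx'] E.
  have [_ _ r1] := fP x hx Ax; have [_ _ r2] := fP x' hx' Ax'.
  by apply: (rinj x x' (f x)) => //; rewrite E.
move=> y /mapP[x]; rewrite !mem_filter mem_zrange => /andP[/asboolP Ax hx] ->.
have [h1 h2 _] := fP x hx Ax.
by rewrite mem_zrange h1 andbT; apply/asboolP.
Qed.

Lemma zcount_split (A B : int -> Prop) (a : int) (L : nat) :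
  (forall x, B x -> A x) ->
  zcount A a L = (zcount B a L + zcount (fun x => A x /\ ~ B x) a L)%N.
Proof.
move=> BA; rewrite /zcount; set p := fun x => `[<B x>].
set q := fun x => `[<_ /\ _>]; rewrite -count_predUI.
have -> : count (predI p q) (zrange a L) = 0%N.
  rewrite (@eq_count _ _ pred0) ?count_pred0 // => x /=.
  by apply/negP => /andP[/asboolP ? /asboolP[]].
rewrite addn0; apply: eq_count => x /=.
apply/asboolP/orP => [Ax|[/asboolP/BA//|/asboolP[]//]].
by have [Bx|nBx] := pselect (B x); [left|right]; apply/asboolP.
Qed.

Section Boxes.
Variables (R : realType) (ball hole : int -> Prop) (U : int -> R)
  (step : int -> nat -> bool).

Definition boxed (c : int) (n : nat) (b : int) : Prop :=
  ball b /\ c - n%:Z <= b <= c + n%:Z.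

(** The number of rounds is the number of sites in the box, which is enough for the iteration to
    become consistent. *)
Definition box_tau (c : int) (n : nat) : int -> option nat :=
  golf_iter hole U step (boxed c n) n.*2.+1.

Lemma boxed_mem c n b : boxed c n b -> b \in zrange (c - n%:Z) n.*2.+1.
Proof. by case=> _; rewrite mem_zrange; lia. Qed.

Lemma box_tau_consistent c n :
  golf_consistent (boxed c n) hole U step (box_tau c n).
Proof.
have := @golf_iter_consistent _ hole U step _ _ (@boxed_mem c n).
by rewrite size_zrange.
Qed.

Definition box_filled (c : int) (n : nat) (h : int) (t : R) : Prop :=
  filled_before (boxed c n) U step (box_tau c n) h t.

Lemma box_filled_sub c n c' n' h t :
  c' - n'%:Z <= c - n%:Z -> c + n%:Z <= c' + n'%:Z ->
  box_filled c n h t -> box_filled c' n' h t.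
Proof.
move=> h1 h2; apply: (filled_mono (@boxed_mem c n) _ _ _ (hole := hole));
  try exact: box_tau_consistent.
by move=> b [bb hb]; split => //; lia.
Qed.

(** The clock induction in [filled_mono] runs over the smaller system only, so a finite box can be
    compared with an evolution on the whole line. *)
Lemma box_filled_consistent tau c n h t : golf_consistent ball hole U step tau ->
  box_filled c n h t -> filled_before ball U step tau h t.
Proof.
move=> C; apply: (filled_mono (@boxed_mem c n) _ (@box_tau_consistent c n) C).
by move=> b [].
Qed.

(** Boxes are centred at [h] so that the notion commutes with translations; every other box lies
    inside one of these. *)
Definition never_filled (h : int) (t : R) : Prop :=
  hole h /\ forall n, ~ box_filled h n h t.

Lemma never_filledP h t : never_filled h t -> forall c n, ~ box_filled c n h t.
Proof.
move=> [_ nf] c n f; apply: (nf (`|(c - h)%R| + n)%N).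
by apply: box_filled_sub f; lia.
Qed.

Lemma never_filled_free h t : never_filled h t ->
  forall c n, free_at (boxed c n) hole U step (box_tau c n) h t.
Proof. by move=> nf; split; [case: nf|apply: never_filledP]. Qed.

Lemma never_filled_anti h s t : s <= t -> never_filled h t -> never_filled h s.
Proof.
move=> st [hh nf]; split => // n /(filled_mono_time st); exact: nf.
Qed.

(** Enlarging a box preserves its filled holes, so the finitely many boxes that serve single sites
    fit into one. *)
Lemma common_box (c : int) (M : nat) (t : R) : (forall i, (i < M)%N -> ~ never_filled (c + i%:Z) t) ->
  exists n, forall x : int, c <= x < c + M%:Z -> hole x -> box_filled 0 n x t.
Proof.
elim: M => [|M IH] H; first by exists 0%N => x; lia.
have [|n hn] := IH; first by move=> i hi; apply: H; lia.
have [hh|nh] := pselect (hole (c + M%:Z)); last first.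
  exists n => x hx hhx; have [E|E] := eqVneq x (c + M%:Z); first by rewrite E in hhx.
  by apply: hn => //; lia.
have [n' hn'] : exists n', box_filled (c + M%:Z) n' (c + M%:Z) t.
  by apply: contrapT => ne; apply: (H M) => //; split => // k fk; apply: ne; exists k.
exists (n + `|(c + M%:Z)%R| + n')%N => x hx hhx; have [->|E] := eqVneq x (c + M%:Z).
  by apply: box_filled_sub hn'; lia.
by apply: (@box_filled_sub 0 n); [lia|lia|apply: hn => //; lia].
Qed.

(** A search for the first failure, cut off at [K]. The cutoff will be taken past the end of a box,
    where no ball starts. *)
Lemma first_failure (Q : nat -> Prop) (K : nat) :
  exists i, (forall k, (k < i)%N -> Q k) /\ (~ Q i \/ i = K).
Proof.
elim: K => [|K [i [h1 [h2|h2]]]]; first by exists 0%N; split; [|right].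
  by exists i; split => //; left.
have [q|nq] := pselect (Q K); last by exists i; split => //; left; rewrite h2.
exists K.+1; split; [|by right] => k; rewrite ltnS leq_eqVlt => /predU1P[->//|].
by rewrite -h2; apply: h1.
Qed.

(* Enlarge the fully filled stretch to an interval that no ball enters from outside: its ends
   are free holes or the ends of the box. *)
Lemma filled_stretch_balls (c : int) (M : nat) (t : R) :
  (forall i, (i < M)%N -> ~ never_filled (c + i%:Z) t) ->
  exists i j, (zcount hole (c - i%:Z) (i + M + j) <=
    zcount (fun b => ball b /\ (U b < t)%R) (c - i%:Z) (i + M + j))%N.
Proof.
move=> /common_box[n hn].
pose full x := hole x -> box_filled 0 n x t.
have notfull x : ~ full x -> free_at (boxed 0 n) hole U step (box_tau 0 n) x t.
  by move=> /not_implyP[hx nf].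
have [i [hi ei]] := @first_failure (fun k => full (c - 1 - k%:Z)) (`|c| + n).
(* The cutoffs push the interval past the box [[-n, n]]. The interval is half-open, so its right end
   needs one site more than its left end. *)
have [j [hj ej]] := @first_failure (fun k => full (c + M%:Z + k%:Z)) (`|c| + n).+1.
exists i, j; apply: (@zcount_le_inj _ _
  (fun h b => exists2 m, box_tau 0 n b = Some m & walk_pos step b m = h)); last first.
  by move=> x x' y _ _ [m E <-] [m' E' <-]; move: E'; rewrite E => -[->].
move=> x hx hhx.
have : box_filled 0 n x t.
  have [x1|x1] := ltP x c.
    have := hi `|(c - 1 - x)%R|%N.
    have -> : c - 1 - Posz `|(c - 1 - x)%R|%N = x by lia.
    by apply => //; lia.
  have [x2|x2] := ltP x (c + M%:Z); first by apply: hn => //; lia.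
  have := hj `|(x - (c + M%:Z))%R|%N.
  have -> : c + M%:Z + Posz `|(x - (c + M%:Z))%R|%N = x by lia.
  by apply => //; lia.
move=> [b [m [bb [lt [E Ex]]]]]; exists b; split; last by exists m.
  have C := @box_tau_consistent 0 n.
  have [_ hb] := bb.
  apply/andP; split.
    case: ei => [/notfull fl|ei]; last by lia.
    by have := stop_same_side C fl bb lt E; rewrite Ex; lia.
  case: ej => [/notfull fl|ej]; last by lia.
  by have := stop_same_side C fl bb lt E; rewrite Ex; lia.
by case: bb.
Qed.

(** Active balls starting in [[k, N - k)] sit between the barriers [x] and [y]. They cannot cross
    them and cannot wander between them forever, so each fills a hole of [[0, N)], which is then not
    a never filled one. *)
Lemma never_filled_balance (N k : nat) (x y : int) (t : R) :
  (forall b b', ball b -> ball b' -> U b = U b' -> b = b') ->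
  (forall b (L : nat), exists n, (L < `|(walk_pos step b n - b)%R|)%N) ->
  never_filled x t -> 0 <= x < k%:Z ->
  never_filled y t -> N%:Z - k%:Z <= y < N%:Z ->
  (zcount (never_filled ^~ t) 0 N +
   zcount (fun b => ball b /\ (U b < t)%R) k (N - k.*2) <= zcount hole 0 N)%N.
Proof.
move=> Uinj unconf Fx hx Fy hy.
rewrite (@zcount_split hole (never_filled ^~ t)) ?leq_add2l; last by move=> z [].
have C := @box_tau_consistent 0 N.
have fx := never_filled_free Fx 0 N; have fy := never_filled_free Fy 0 N.
apply: (@zcount_le_inj _ _ (fun b h => [/\ boxed 0 N b, U b < t &
  exists2 m, box_tau 0 N b = Some m & walk_pos step b m = h])); last first.
  move=> b b' h _ _ [bb lt [m E Eh]] [bb' lt' [m' E' Eh']].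
  (* A hole filled at an earlier clock is not free for a later ball. Equal clocks escape this
     argument, as [filled_before] is strict; they are excluded by [Uinj]. *)
  have earlier c c' n n' : boxed 0 N c -> boxed 0 N c' -> U c < U c' ->
      box_tau 0 N c = Some n -> box_tau 0 N c' = Some n' ->
      walk_pos step c n = walk_pos step c' n' -> False.
    move=> hc hc' cc' En /(C c').1 [//|[_ nf] _] Enn; apply: nf.
    by exists c, n; split.
  apply: Uinj; [by case: bb|by case: bb'|].
  have [Ul|Ul|//] := ltgtP (U b) (U b').
    by exfalso; apply: (earlier b b' m m') => //; rewrite Eh.
  by exfalso; apply: (earlier b' b m' m) => //; rewrite Eh.
move=> b hb [bb lt].
have Bb : boxed 0 N b by split => //; lia.
have hxy : x < b < y by lia.
case E : (box_tau 0 N b) => [m|]; last first.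
  (* A displacement larger than [N] takes the walk past [x] or [y], which are free at the clock time
     of [b], so the ball would have stopped. *)
  exfalso; have [n hn] := unconf b N.
  have stay p : ~ free_at (boxed 0 N) hole U step (box_tau 0 N) (walk_pos step b p) (U b).
    move: E; rewrite ((golf_nextP _ _ _ _ _).1 C b) /golf_next.
    by case: pselect => //= _ /first_hit_None.
  have [q _ Eq] : exists2 q, (q <= n)%N & walk_pos step b q = x \/ walk_pos step b q = y.
    have [h|h] := ltP b (walk_pos step b n).
      by have [|q ? ?] := @walk_pos_hits step b y n; [lia|exists q; [|right]].
    by have [|q ? ?] := @walk_pos_hits step b x n; [lia|exists q; [|left]].
  apply: (stay q); case: Eq => ->; [move: fx|move: fy]; apply: free_anti_time; exact: ltW.
have s1 := stop_same_side C fx Bb lt E; have s2 := stop_same_side C fy Bb lt E.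
have /(C b).1 [//|[hm _] _] := E.
exists (walk_pos step b m); split; [lia| |by split => //; exists m].
split=> // /never_filledP /(_ 0 N); apply.
by exists b, m; split.
Qed.

Lemma uniform_bound (s : seq int) (Q : int -> nat -> Prop) :
  (forall b, b \in s -> exists N, forall n, (N <= n)%N -> Q b n) ->
  exists N, forall b n, b \in s -> (N <= n)%N -> Q b n.
Proof.
elim: s => [|a s IH] H; first by exists 0%N.
have [|N hN] := IH; first by move=> b bs; apply: H; rewrite inE bs orbT.
have [N' hN'] := H a (mem_head _ _).
exists (N + N')%N => b n; rewrite inE => /predU1P[->|bs] le.
  by apply: hN'; lia.
by apply: hN => //; lia.
Qed.

Lemma uniform_box (w : nat -> int) (m : nat) (t : R) :
  (forall k, (k < m)%N -> hole (w k) -> exists n, box_filled 0 n (w k) t) ->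
  exists n, forall k, (k < m)%N -> hole (w k) -> box_filled 0 n (w k) t.
Proof.
elim: m => [|m IH] H; first by exists 0%N.
have [|n hn] := IH; first by move=> k km; apply: H; lia.
have [hm|nhm] := pselect (hole (w m)); last first.
  exists n => k; rewrite ltnS leq_eqVlt => /predU1P[->//|]; exact: hn.
have [n' hn'] := H m (ltnSn m) hm.
exists (n + n')%N => k; rewrite ltnS leq_eqVlt => /predU1P[->//|km] hk.
  by apply: box_filled_sub hn'; lia.
by apply: box_filled_sub (hn k km hk); lia.
Qed.

(* The infinite-volume process is the increasing limit of the box processes. A free hole on
   each side confines the balls that can fill [h], so one of them does so in infinitely many
   boxes. *)
Lemma golf_consistent_exists :
  (forall b, U b < 1) ->
  (forall s, s < 1 -> forall z : int, (exists2 x : int, x < z & never_filled x s) /\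
                                (exists2 y : int, z < y & never_filled y s)) ->
  exists tau, golf_consistent ball hole U step tau.
Proof.
move=> U1 Funb.
pose filled_lim h t := exists n, box_filled 0 n h t.
pose free_lim h t := hole h /\ ~ filled_lim h t.
pose tau b := if pselect (ball b) then first_hit (free_lim ^~ (U b)) (walk_pos step b)
              else None.
have tauP b n : ball b -> tau b = Some n <-> free_lim (walk_pos step b n) (U b) /\
    forall m, (m < n)%N -> ~ free_lim (walk_pos step b m) (U b).
  by move=> bb; rewrite /tau; case: pselect => //= _; exact: (first_hitP (free_lim ^~ (U b))).
(* Consistency tests holes only at clock times. These are smaller than 1, where barriers on both
   sides are available. *)
suff key h b0 : filled_before ball U step tau h (U b0) <-> filled_lim h (U b0).
  exists tau => b; split=> [bb n|nb]; last by rewrite /tau; case: pselect.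
  have E h : free_at ball hole U step tau h (U b) <-> free_lim h (U b).
    by rewrite /free_at /free_lim key.
  apply: (iff_trans (tauP b n bb)); split=> -[/E h1 h2]; split => // m /h2 nf /E; exact: nf.
split.
  move=> [b [m [bb [lt [/(tauP b m bb) [[hm nfm] minm] <-]]]]].
  have [|n hn] := @uniform_box (walk_pos step b) m (U b).
    by move=> k km hk; apply: contrapT => nf; exact: (minm k km).
  (* This box contains [b] and has filled every hole that the walk visits before step [m], so [b]
     stops at step [m] in it too. *)
  pose N := (n + `|b|)%N; exists N, b, m.
  have Bb : boxed 0 N b by split => //; lia.
  do 3!split => //; apply/((@box_tau_consistent 0 N b).1 Bb); split.
    by split => // f; apply: nfm; exists N.
  move=> k km [hk]; apply; apply: box_filled_sub (hn k km hk); lia.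
move=> [n0 fn0].
pose s := U b0.
have [[x xh Fx] [y hy Fy]] := Funb s (U1 b0) h.
apply: contrapT => nfill.
(* If no ball fills [h] in the limit, each ball between the barriers fills [h] in boundedly many
   boxes only; a box beyond all these bounds gives the contradiction. *)
have [|N hN] := @uniform_bound (zrange x `|(y - x)%R|%N)
  (fun b n => ~ (boxed 0 n b /\ U b < s /\
     exists2 m, box_tau 0 n b = Some m & walk_pos step b m = h)).
  move=> b _; apply: contrapT => often.
  have {}often N : exists n, [/\ (N <= n)%N, boxed 0 n b, U b < s &
      exists2 m, box_tau 0 n b = Some m & walk_pos step b m = h].
    apply: contrapT => ne; apply: often; exists N => n Nn [h1 [h2 h3]]; apply: ne.
    by exists n.
  have [n1 [_ [bb _] lt [m1 _ Em1]]] := often 0%N.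
  (* A ball that fills [h] does so at its first visit to [h], so the stopping step is the same in
     all boxes concerned. *)
  have [m Em] : exists m, first_hit (eq^~ h) (walk_pos step b) = Some m.
    by case E : first_hit => [m|]; [exists m|case: (first_hit_None E Em1)].
  have [wm minm] := (first_hitP (eq^~ h) _ m).1 Em.
  have {}often N : exists n, [/\ (N <= n)%N, boxed 0 n b & box_tau 0 n b = Some m].
    have [n [Nn Bb _ [m' E' wm']]] := often N; exists n; split => //; rewrite E'.
    have [fm' minm'] := ((@box_tau_consistent 0 n b).1 Bb m').1 E'.
    have [lt1|lt1|->//] := ltngtP m m'.
      by exfalso; apply: (minm' m lt1); rewrite wm -wm'.
    by exfalso; apply: (minm m' lt1).
  (* Being filled passes to larger boxes: [h] is free in arbitrarily large boxes, hence in the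
     limit, while the sites visited earlier are already excluded in one box. *)
  apply: nfill; exists b, m; do 3!split => //; apply/(tauP b m bb); split.
    have [n [_ Bb E]] := often 0%N.
    split; first by case: (((@box_tau_consistent 0 n b).1 Bb m).1 E) => -[].
    move=> [k fk]; have [n' [kn Bb' E']] := often k.
    have [[_ nf] _] := ((@box_tau_consistent 0 n' b).1 Bb' m).1 E'.
    by apply: nf; apply: box_filled_sub fk; lia.
  move=> k km [hk nf]; have [n [_ Bb E]] := often 0%N.
  have [_ /(_ k km)] := ((@box_tau_consistent 0 n b).1 Bb m).1 E.
  by apply; split => // f; apply: nf; exists n.
pose n := (N + n0 + `|x| + `|y|)%N.
have [b [m [Bb [lt [E wm]]]]] : box_filled 0 n h s by apply: box_filled_sub fn0; lia.
apply: (hN b n); [|lia|by split => //; split => //; exists m].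
have C := @box_tau_consistent 0 n.
have s1 := stop_same_side C (never_filled_free Fx 0 n) Bb lt E.
have s2 := stop_same_side C (never_filled_free Fy 0 n) Bb lt E.
by rewrite mem_zrange; lia.
Qed.

End Boxes.

(** * Deviation of the number of balls *)

Section ProbabilityValues.
Context {d} {T : measurableType d} {R : realType} (P : probability T R).

Definition pr (A : set T) : R := fine (P A).

Lemma EFin_pr A : measurable A -> P A = (pr A)%:E.
Proof. by move=> mA; rewrite /pr fineK // fin_num_measure. Qed.

Lemma pr_ge0 A : 0 <= pr A.
Proof. exact: fine_ge0. Qed.

Lemma pr_setT : pr setT = 1.
Proof. by rewrite /pr probability_setT. Qed.

Lemma pr_set0 : pr set0 = 0.
Proof. by rewrite /pr measure0. Qed.

Lemma le_pr A B : measurable A -> measurable B -> A `<=` B -> pr A <= pr B.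
Proof.
by move=> mA mB AB; rewrite -lee_fin -!EFin_pr //; apply: le_measure; rewrite ?inE.
Qed.

Lemma prU A B : measurable A -> measurable B -> [disjoint A & B]%classic ->
  pr (A `|` B) = pr A + pr B.
Proof.
move=> mA mB AB; apply: EFin_inj; rewrite EFinD -!EFin_pr //; last exact: measurableU.
by rewrite measureU //; apply/eqP; rewrite -disj_set2E.
Qed.

Lemma prU_le A B : measurable A -> measurable B -> pr (A `|` B) <= pr A + pr B.
Proof.
move=> mA mB; rewrite -lee_fin EFinD -!EFin_pr //; last exact: measurableU.
exact: measureU2.
Qed.

Lemma prID A B : measurable A -> measurable B -> pr A = pr (A `&` B) + pr (A `&` ~` B).
Proof.
move=> mA mB; rewrite -prU; last 3 first.
- exact: measurableI.
- by apply: measurableI => //; apply: measurableC.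
- by apply/disj_setPS => x [[_ ?] [_]].
by rewrite -setIUr setUv setIT.
Qed.

Lemma prC A : measurable A -> pr (~` A) = 1 - pr A.
Proof. by move=> mA; rewrite -pr_setT (prID measurableT mA) !setTI; ring. Qed.

Lemma pr_bigcup_geometric (A : nat -> set T) (K r : R) :
  (forall n, measurable (A n)) -> 0 <= r < 1 -> 0 <= K ->
  (forall n, pr (A n) <= K * r ^+ n) -> pr (\bigcup_n A n) <= K / (1 - r).
Proof.
move=> mA /andP[r0 r1] K0 H; have mU : measurable (\bigcup_n A n) by exact: bigcup_measurable.
rewrite -lee_fin -EFin_pr //.
apply: le_trans (measure_sigma_subadditive P mA mU (@subset_refl _ _)) _.
apply: lime_le; first by apply: is_cvg_nneseries.
apply: nearW => n.
suff : (\sum_(0 <= i < n) P (A i) <= (K * ((1 - r ^+ n) / (1 - r)))%:E)%E.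
  move/le_trans; apply; rewrite lee_fin; apply: ler_wpM2l => //.
  by rewrite ler_pdivrMr ?subr_gt0 // mulVf ?lerBlDr ?lerDl ?exprn_ge0 // gt_eqF ?subr_gt0.
elim: n => [|n IH]; first by rewrite big_nil expr0 subrr mul0r mulr0.
rewrite big_nat_recr //= EFin_pr //.
apply: le_trans (leeD IH (_ : _ <= (K * r ^+ n)%:E)%E) _; first by rewrite lee_fin.
rewrite -EFinD lee_fin exprS le_eqVlt; apply/orP; left; apply/eqP.
by field; rewrite subr_eq0 gt_eqF.
Qed.

Lemma expr_le0 (x y : R) : 0 <= x < 1 -> (forall n, y <= x ^+ n) -> y <= 0.
Proof.
move=> /andP[x0 x1] H.
have c : (fun n => x ^+ n) @ \oo --> (0 : R) by apply: cvg_expr; rewrite ger0_norm.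
by apply: (ler_cvg_to (cvg_cst y) c); apply: nearW.
Qed.

Lemma pr_negligible A : measurable A -> pr A <= 0 -> P.-negligible A.
Proof.
move=> mA h; exists A; split => //; rewrite EFin_pr //; congr EFin.
by apply/eqP; rewrite eq_le h pr_ge0.
Qed.

Lemma negligible_exists (I : countType) (F : I -> set T) :
  (forall i, P.-negligible (F i)) -> P.-negligible [set w | exists i, F i w].
Proof.
move=> H; have N : P.-negligible (\bigcup_n (if unpickle n is Some i then F i else set0)).
  by apply: negligible_bigcup => n; case: unpickle => //; exact: negligible_set0.
apply: negligibleS N => w [i Fi]; exists (pickle i) => //; by rewrite pickleK.
Qed.

End ProbabilityValues.

(** * Product events over finitely many coordinates *)

Section Rectangles.
Context {d} {T : measurableType d} {R : realType} (P : probability T R).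
Context (I : eqType) (X : I -> T -> R).
Hypotheses (mX : forall j, measurable_fun setT (X j))
  (indX : mutually_independent P X).

(** [J] lists the coordinates on which the event may depend, so that independence from a new
    coordinate becomes a membership test. *)
Definition rect (J : seq I) (D : set T) : Prop := uniq J /\
  exists2 B : I -> set R, (forall j, measurable (B j)) &
    D = \bigcap_(j in [set` J]) (X j @^-1` B j).

Lemma rect_nil : rect [::] setT.
Proof. by split => //; exists (fun=> setT) => //; apply/seteqP; split=> w //= _ j. Qed.

Lemma measurable_coord j (B : set R) : measurable B -> measurable (X j @^-1` B).
Proof. by move=> mB; rewrite -[X in measurable X]setTI; apply: mX. Qed.

Lemma rect_measurable J D : rect J D -> measurable D.
Proof.
move=> [_ [B mB ->]]; elim: J => [|j J IH].
  by rewrite (_ : \bigcap_(_ in _) _ = setT) //; apply/seteqP; split=> w //= _ j.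
rewrite (_ : \bigcap_(_ in _) _ =
    (X j @^-1` B j) `&` \bigcap_(k in [set` J]) (X k @^-1` B k)).
  by apply: measurableI => //; exact: measurable_coord.
apply/seteqP; split=> w /=.
  by move=> h; split=> [|k kJ]; apply: h; rewrite /= inE ?eqxx // kJ orbT.
by move=> [h1 h2] k /=; rewrite inE => /predU1P[->//|]; exact: h2.
Qed.

(** Independence is given for products only, so the intersection is rewritten as a product over
    [j :: J]. Being a rectangle again, it can be extended further. *)
Lemma rect_cons J D j (B : set R) : rect J D -> j \notin J -> measurable B ->
  rect (j :: J) (D `&` X j @^-1` B) /\
  pr P (D `&` X j @^-1` B) = pr P D * pr P (X j @^-1` B).
Proof.
move=> [uJ [B' mB' ED]] jJ mB.
pose B'' k := if k == j then B else B' k.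
have mB'' k : measurable (B'' k) by rewrite /B''; case: ifP.
have uj : uniq (j :: J) by rewrite /= jJ uJ.
have E : D `&` X j @^-1` B = \bigcap_(k in [set` j :: J]) (X k @^-1` B'' k).
  rewrite ED; apply/seteqP; split=> w.
    move=> [h1 h2] k /=; rewrite inE /B'' => /predU1P[->|kJ]; first by rewrite eqxx.
    by have := h1 k kJ; case: eqP => // kj; rewrite kj (negbTE jJ) in kJ.
  move=> h; split=> [k kJ|].
    have := h k; rewrite /= inE kJ orbT /B'' => /(_ isT); case: eqP => // kj.
    by rewrite kj /= (negbTE jJ) in kJ.
  by have := h j; rewrite /= inE eqxx /B'' eqxx; apply.
split; first by split => //; exists B''.
rewrite {1}/pr E indX // /= big_cons /B'' eqxx mulrC; congr (_ * _).
rewrite /pr ED indX //=; apply: eq_big_seq => k kJ.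
by case: eqP => // kj; rewrite kj (negbTE jJ) in kJ.
Qed.

End Rectangles.

Lemma zcountS (A : int -> Prop) (a : int) (n : nat) :
  zcount A a n.+1 = (zcount A a n + `[<A (a + n%:Z)%R>])%N.
Proof. by rewrite /zcount /zrange -addn1 iotaD map_cat count_cat /= addn0. Qed.

Lemma window_last (a : int) (n : nat) : a <= a + n%:Z < a + n.+1%:Z.
Proof. lia. Qed.

Lemma window_widen (a i : int) (n : nat) : a <= i < a + n%:Z -> a <= i < a + n.+1%:Z.
Proof. lia. Qed.

Lemma one_neq_two (R : realType) : (1 : R) <> 2.
Proof. by apply/eqP; rewrite (eqr_nat R 1 2). Qed.

Section SurplusSets.
Context {d} {T : measurableType d} {R : realType}.
Variables (st clk : int -> T -> R) (stp : int -> nat -> T -> R).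

Definition active_ball (t : R) (w : T) (b : int) : Prop :=
  ball_of st w b /\ clock_of clk w b < t.

(** The level [j] is arbitrary, although only 0 is of interest, because adding a site shifts it. *)
Definition surplus_le (t : R) (a : int) (n : nat) (j : int) : set T :=
  [set w | (zcount (hole_of st w) a n)%:Z - (zcount (active_ball t w) a n)%:Z <= j].

Lemma surplus_le0 t a (j : int) : surplus_le t a 0 j = if 0 <= j then setT else set0.
Proof.
rewrite /surplus_le /zcount /=; apply/seteqP.
by case: ifP => h; split=> w //=; lia.
Qed.

(** Case split on the new site: hole, active ball, ball with a later clock, anything else. The last
    case is a complement, as states other than 0, 1, 2 are excluded only up to a null set. *)
Lemma surplus_leS t a n j : surplus_le t a n.+1 j =
  ((surplus_le t a n (j - 1) `&` st (a + n%:Z) @^-1` [set 2]) `|`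
   (surplus_le t a n (j + 1) `&` (st (a + n%:Z) @^-1` [set 1] `&`
                                  clk (a + n%:Z) @^-1` [set y | y < t]))) `|`
  ((surplus_le t a n j `&` (st (a + n%:Z) @^-1` [set 1] `&`
                                  clk (a + n%:Z) @^-1` (~` [set y | y < t]))) `|`
   (surplus_le t a n j `&` st (a + n%:Z) @^-1` ~` ([set 1] `|` [set 2]))).
Proof.
have n12 := @one_neq_two R.
apply/seteqP; split=> w; rewrite /surplus_le /= !zcountS !PoszD /hole_of /active_ball
    /ball_of /clock_of.
  case: asboolP => E2; case: asboolP => E1 h.
  - by case: E1; rewrite E2 => /esym.
  - by left; left; split => //; lia.
  - by left; right; case: E1 => E1 C; do !split => //=; lia.
  - right; have [E|n1] := pselect (st (a + n%:Z) w = 1).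
      by left; split; [rewrite /=; lia|split => //= C; apply: E1].
    by right; split => /=; [lia|case].
case: asboolP => E2; case: asboolP => E1.
- by case: E1; rewrite E2 => /esym.
- move=> [[[h E]|[h [E C]]]|[[h [E C]]|[h nn]]]; first by lia.
  + by case: E1.
  + by move: E2; rewrite E => /n12.
  + by case: nn; right.
- move=> [[[h E]|[h [E C]]]|[[h [E C]]|[h nn]]]; first by case: E2.
  + by lia.
  + by case: C; case: E1.
  + by case: nn; left; case: E1.
- move=> [[[h E]|[h [E C]]]|[[h [E C]]|[h nn]]]; first by case: E2.
  + by case: E1.
  + by lia.
  + by lia.
Qed.

(** How far the interval of [filled_stretch_balls] overhangs the window on each side is random,
    hence the double union. *)
Definition gap_cover (t : R) (c : int) (M : nat) : set T :=
  \bigcup_i \bigcup_j surplus_le t (c - i%:Z) (i + M + j) 0.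

Let ball w := ball_of st w.
Let hole w := hole_of st w.
Let U w := clock_of clk w.
Let step w := step_of stp w.

Lemma gap_coverP t c M w :
  (forall i, (i < M)%N -> ~ never_filled (ball w) (hole w) (U w) (step w) (c + i%:Z) t) ->
  gap_cover t c M w.
Proof.
move=> /filled_stretch_balls [i [j h]]; exists i => //; exists j => //.
rewrite /surplus_le /=; move: h; rewrite /active_ball /hole /ball /U; lia.
Qed.

End SurplusSets.

Section GolfEvents.
Context {d} {T : measurableType d} {R : realType} (P : probability T R).
Variables (rho p : R) (st clk : int -> T -> R) (stp : int -> nat -> T -> R).
Hypothesis law : golf_law P rho rho p st clk stp.

Let X : golf_index -> T -> R := golf_family st clk stp.

Let mX j : measurable_fun setT (X j).
Proof. by case: law => h _; exact: h. Qed.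
Let indX : mutually_independent P X.
Proof. by case: law => _ [_ [_ []]]. Qed.

Let mcoord (j : golf_index) (B : set R) : measurable B -> measurable (X j @^-1` B).
Proof. exact: measurable_coord. Qed.

Let mst i B : measurable B -> measurable (st i @^-1` B).
Proof. exact: (mcoord (inl (inl i))). Qed.
Let mclk i B : measurable B -> measurable (clk i @^-1` B).
Proof. exact: (mcoord (inl (inr i))). Qed.
Lemma pr_ball i : pr P (st i @^-1` [set 1]) = rho.
Proof. by case: law => _ [/(_ i)[h _] _]; rewrite /pr h. Qed.

Lemma pr_hole i : pr P (st i @^-1` [set 2]) = rho.
Proof. by case: law => _ [/(_ i)[_ [h _]] _]; rewrite /pr h. Qed.

Lemma pr_neutral i : pr P (st i @^-1` ~` ([set 1] `|` [set 2])) = 1 - rho - rho.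
Proof.
rewrite -preimage_setC prC; last by apply: mst; apply: measurableU.
rewrite preimage_setU prU ?pr_ball ?pr_hole; [by ring|exact: mst|exact: mst|].
by apply/disj_setPS => w [/= ->] /one_neq_two.
Qed.

Lemma pr_clk_le i x : 0 <= x <= 1 -> pr P (clk i @^-1` [set y | y <= x]) = x.
Proof. by case: law => _ [_ [/(_ i x) h _]] /h; rewrite /pr => ->. Qed.

Lemma measurable_le_set (x : R) : measurable [set y : R | y <= x].
Proof. by rewrite -set_itvE. Qed.

Lemma measurable_lt_set (x : R) : measurable [set y : R | y < x].
Proof. by rewrite -set_itvE. Qed.

(** The law gives the distribution function only; comparison with [x - e] shows that there is no
    atom at [x]. *)
Lemma pr_clk_lt i x : 0 < x <= 1 -> pr P (clk i @^-1` [set y | y < x]) = x.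
Proof.
move=> /andP[x0 x1]; have m1 := mclk i (measurable_lt_set x).
apply/eqP; rewrite eq_le; apply/andP; split.
  rewrite -[leRHS](@pr_clk_le i) ?(ltW x0) //; apply: le_pr => //.
    by apply: mclk; exact: measurable_le_set.
  by move=> w /= /ltW.
apply/ler_addgt0Pr => e e0.
have [ex|xe] := leP x e; first by have := pr_ge0 P (clk i @^-1` [set y | y < x]); lra.
rewrite -lerBlDr -[leLHS](@pr_clk_le i); last by apply/andP; split; lra.
apply: le_pr => //; first by apply: mclk; exact: measurable_le_set.
by move=> w /=; lra.
Qed.

Lemma pr_clk_ge i x : 0 < x <= 1 -> pr P (clk i @^-1` (~` [set y | y < x])) = 1 - x.
Proof.
move=> hx; rewrite -preimage_setC prC ?pr_clk_lt //.
by apply: mclk; exact: measurable_lt_set.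
Qed.

Lemma measurable_surplus_le t a n j : measurable (surplus_le st clk t a n j).
Proof.
elim: n j => [|n IH] j.
  by rewrite surplus_le0; case: ifP.
have m1 : measurable (clk (a + n%:Z) @^-1` [set y | y < t]).
  by apply: mclk; exact: measurable_lt_set.
rewrite surplus_leS; apply: measurableU; apply: measurableU; apply: measurableI => //;
  try apply: measurableI => //; try exact: mst.
  by rewrite -preimage_setC; apply: measurableC.
by apply: mst; apply: measurableC; apply: measurableU.
Qed.

Lemma measurable_gap_cover t c M : measurable (gap_cover st clk t c M).
Proof.
by apply: bigcup_measurable => i _; apply: bigcup_measurable => j _; exact: measurable_surplus_le.
Qed.

(* Any base strictly between [1] and [1 / t] makes [decay t] smaller than [1]. *)
Definition tilt (t : R) : R := 2 / (1 + t).
(** Expectation of [tilt t] raised to active balls minus holes at one site; the terms are hole,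
    active ball, ball with a later clock, and neither. *)
Definition decay (t : R) : R :=
  rho / tilt t + rho * t * tilt t + rho * (1 - t) + (1 - rho - rho).

Hypotheses (rho_ge0 : 0 <= rho) (rho_le : rho + rho <= 1).

(** For [z = tilt t] one has [decay t - 1 = rho * (1 - z) * (1 - t * z) / z], negative for
    [1 < z < 1 / t]. With the chosen [z] the upper bound is an identity. *)
Lemma decay_bound t : 0 < t < 1 -> 0 <= decay t <= 1 - rho * (1 - t) ^+ 2 / (2 * (1 + t)).
Proof.
move=> /andP[t0 t1]; have z0 : 0 < tilt t by rewrite /tilt divr_gt0 //; lra.
apply/andP; split.
  have a1 : 0 <= rho / tilt t by rewrite divr_ge0 ?(ltW z0).
  have a2 : 0 <= rho * t * tilt t by apply: mulr_ge0; [apply: mulr_ge0 => //|]; exact: ltW.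
  have a3 : 0 <= rho * (1 - t) by apply: mulr_ge0 => //; lra.
  by rewrite /decay; apply: addr_ge0; [apply: addr_ge0 => //; exact: addr_ge0|have := rho_le; lra].
rewrite le_eqVlt; apply/orP; left; apply/eqP; rewrite /decay /tilt; field.
by rewrite gt_eqF //; lra.
Qed.

(* Exponential Markov inequality, run site by site; keeping the intersection with a rectangle
   [D] over other coordinates makes the induction go through. *)
Lemma surplus_le_rect t a n j J D : 0 < t < 1 -> rect X J D ->
  (forall i, a <= i < a + n%:Z -> inl (inl i) \notin J /\ inl (inr i) \notin J) ->
  pr P (surplus_le st clk t a n j `&` D) <= decay t ^+ n * tilt t ^ j * pr P D.
Proof.
move=> /[dup] ht /andP[t0 t1]; have z1 : 1 < tilt t.
  by rewrite /tilt ltr_pdivlMr; lra.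
have z0 : tilt t != 0 by rewrite gt_eqF //; lra.
have tl : 0 < t <= 1 by rewrite t0 ltW.
elim: n j J D => [|n IH] j J D rD dJ.
  rewrite expr0 mul1r.
  rewrite surplus_le0; case: ifP => h; last first.
    by rewrite set0I pr_set0 mulr_ge0 ?pr_ge0 ?exprz_ge0 //; lra.
  case: j h => // k _; rewrite setTI; apply: ler_peMl; first exact: pr_ge0.
  by apply: exprn_ege1; exact: ltW.
set i := (a + n%:Z)%R.
have [iJ1 iJ2] := dJ i (window_last a n).
have dJn i' : a <= i' < a + n%:Z -> inl (inl i') \notin J /\ inl (inr i') \notin J.
  by move=> /window_widen; exact: dJ.
have m1 := measurable_lt_set t.
have m1c : measurable (~` [set y : R | y < t]) by exact: measurableC.
have m0 : measurable (~` ([set 1] `|` [set 2]) : set R).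
  by apply: measurableC; apply: measurableU.
have [r1 p1] := rect_cons indX (j := inl (inl i)) rD iJ1 (measurable_set1 (2:R)).
have [r2 p2] := rect_cons indX (j := inl (inl i)) rD iJ1 (measurable_set1 (1:R)).
have iJ2' : (inl (inr i) : golf_index) \notin inl (inl i) :: J by rewrite inE.
have [r3 p3] := rect_cons indX r2 iJ2' m1.
have [r4 p4] := rect_cons indX r2 iJ2' m1c.
have [r5 p5] := rect_cons indX (j := inl (inl i)) rD iJ1 m0.
have fresh1 i' : a <= i' < a + n%:Z ->
    (inl (inl i') : golf_index) \notin inl (inl i) :: J /\ inl (inr i') \notin (inl (inl i) : golf_index) :: J.
  move=> /[dup] /dJn[h1 h2] h; rewrite !inE !negb_or h1 h2 !andbT; split => //.
  by apply/eqP => -[E]; move: h; rewrite E ltxx andbF.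
have fresh2 i' : a <= i' < a + n%:Z -> (inl (inl i') : golf_index) \notin inl (inr i) :: inl (inl i) :: J /\
    (inl (inr i') : golf_index) \notin inl (inr i) :: inl (inl i) :: J.
  move=> /[dup] /fresh1[h1 h2] h; rewrite inE negb_or h1 inE negb_or h2 !andbT; split => //.
  by apply/eqP => -[E]; move: h; rewrite E ltxx andbF.
have b1 := IH (j - 1) _ _ r1 fresh1.
have b2 := IH (j + 1) _ _ r3 fresh2.
have b3 := IH j _ _ r4 fresh2.
have b4 := IH j _ _ r5 fresh1.
have S m j' D' J' : rect X J' D' -> measurable (surplus_le st clk t a m j' `&` D').
  move=> rD'; apply: measurableI; first exact: measurable_surplus_le.
  exact: (rect_measurable mX rD').
have M1 := S n (j - 1) _ _ r1; have M2 := S n (j + 1) _ _ r3.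
have M3 := S n j _ _ r4; have M4 := S n j _ _ r5.
(* The shifts of [j] by one yield factors [(tilt t)^-1] and [tilt t]; with the probabilities of the
   four cases they add up to one more factor [decay t]. *)
have sums := lerD (lerD b1 b2) (lerD b3 b4).
rewrite surplus_leS -/i.
have E : (((surplus_le st clk t a n (j - 1) `&` st i @^-1` [set 2]) `|`
   (surplus_le st clk t a n (j + 1) `&` (st i @^-1` [set 1] `&` clk i @^-1` [set y | y < t]))) `|`
  ((surplus_le st clk t a n j `&` (st i @^-1` [set 1] `&` clk i @^-1` (~` [set y | y < t]))) `|`
   (surplus_le st clk t a n j `&` st i @^-1` ~` ([set 1] `|` [set 2])))) `&` D =
  ((surplus_le st clk t a n (j - 1) `&` (D `&` st i @^-1` [set 2])) `|`
   (surplus_le st clk t a n (j + 1) `&` (D `&` st i @^-1` [set 1] `&` clk i @^-1` [set y | y < t]))) `|`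
  ((surplus_le st clk t a n j `&` (D `&` st i @^-1` [set 1] `&` clk i @^-1` (~` [set y | y < t]))) `|`
   (surplus_le st clk t a n j `&` (D `&` st i @^-1` ~` ([set 1] `|` [set 2])))).
  by rewrite !setIUl; congr ((_ `|` _) `|` (_ `|` _)); apply/seteqP; split=> w /=; tauto.
rewrite E; apply: (le_trans (prU_le P (measurableU _ _ M1 M2) (measurableU _ _ M3 M4))).
apply: (le_trans (lerD (prU_le P M1 M2) (prU_le P M3 M4))).
apply: (le_trans sums).
have -> : pr P (D `&` X (inl (inl i)) @^-1` [set 2]) = pr P D * rho by rewrite p1 pr_hole.
have -> : pr P (D `&` X (inl (inl i)) @^-1` [set 1] `&` X (inl (inr i)) @^-1` [set y | y < t]) =
  pr P D * rho * t by rewrite p3 p2 pr_ball pr_clk_lt.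
have -> : pr P (D `&` X (inl (inl i)) @^-1` [set 1] `&` X (inl (inr i)) @^-1` (~` [set y | y < t])) =
  pr P D * rho * (1 - t) by rewrite p4 p2 pr_ball pr_clk_ge.
have -> : pr P (D `&` X (inl (inl i)) @^-1` ~` ([set 1] `|` [set 2])) = pr P D * (1 - rho - rho).
  by rewrite p5 pr_neutral.
rewrite !expfzDr // exprS /decay expr1z.
have -> : tilt t ^ (-1) = (tilt t)^-1 by [].
rewrite le_eqVlt; apply/orP; left; apply/eqP; ring.
Qed.

Lemma pr_surplus_le t a n : 0 < t < 1 -> pr P (surplus_le st clk t a n 0) <= decay t ^+ n.
Proof.
move=> ht; have := @surplus_le_rect t a n 0 [::] setT ht (rect_nil _) _.
by rewrite setIT pr_setT !mulr1; apply.
Qed.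

Let ball w := ball_of st w.
Let hole w := hole_of st w.
Let U w := clock_of clk w.
Let step w := step_of stp w.

Hypothesis rho_gt0 : 0 < rho.

Lemma decay_lt1 t : 0 < t < 1 -> 0 <= decay t < 1.
Proof.
move=> /[dup] ht /decay_bound /andP[-> h] /=; move: ht => /andP[t0 t1].
apply: le_lt_trans h _; rewrite ltrBlDr ltrDl divr_gt0 ?mulr_gt0 ?exprn_gt0 ?subr_gt0 //; lra.
Qed.

(** Union bound over both overhangs: two geometric series, each contributing a factor
    [1 / (1 - decay t)]. *)
Lemma pr_gap_cover t c M : 0 < t < 1 ->
  pr P (gap_cover st clk t c M) <= decay t ^+ M / (1 - decay t) ^+ 2.
Proof.
move=> ht; have /andP[r0 r1] := decay_lt1 ht.
have r01 : 0 <= decay t < 1 by rewrite r0.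
rewrite expr2 invfM mulrA; apply: pr_bigcup_geometric => //.
- by move=> i; apply: bigcup_measurable => j _; exact: measurable_surplus_le.
- by rewrite divr_ge0 ?exprn_ge0 // subr_ge0 ltW.
move=> i; rewrite mulrAC -exprD; apply: pr_bigcup_geometric => //.
- by move=> j; exact: measurable_surplus_le.
- exact: exprn_ge0.
move=> j; apply: le_trans (pr_surplus_le _ _ ht) _.
by rewrite -exprD (addnC M i).
Qed.

(** If one side of [z] has no never filled hole, the windows of every length [M] next to [z] on that
    side are gaps, and their covers have probability tending to 0. *)
Lemma never_filled_unbounded t : 0 < t < 1 ->
  P.-negligible [set w | ~ forall z : int,
    (exists2 x : int, x < z & never_filled (ball w) (hole w) (U w) (step w) x t) /\
    (exists2 y : int, z < y & never_filled (ball w) (hole w) (U w) (step w) y t)].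
Proof.
move=> ht; have r01 := decay_lt1 ht.
have N (c : nat -> int) : P.-negligible (\bigcap_M gap_cover st clk t (c M) M).
  have mI : measurable (\bigcap_M gap_cover st clk t (c M) M).
    by apply: bigcapT_measurable => M; exact: measurable_gap_cover.
  apply: pr_negligible => //.
  have K0 : 0 < (1 - decay t) ^+ 2 by rewrite exprn_gt0 // subr_gt0; case/andP: r01.
  rewrite -(pmulr_lle0 _ K0); apply: (expr_le0 r01) => M.
  rewrite -ler_pdivlMr //; apply: le_trans (pr_gap_cover (c M) M ht).
  by apply: le_pr => //; [exact: measurable_gap_cover|move=> w; apply].
have N2 : P.-negligible [set w | exists z : int, exists b : bool,
    (\bigcap_M gap_cover st clk t (if b then z + 1 else z - M%:Z) M) w].
  apply: negligible_exists => z; apply: negligible_exists => b.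
  exact: (N (fun M : nat => if b then z + 1 else z - M%:Z)).
apply: negligibleS N2 => w /existsNP[z] /not_andP H.
(* [false] stands for the windows [[z - M, z)] on the left, [true] for those starting at [z + 1]. *)
exists z; have [H1|H1] := H; [exists false|exists true]; move=> M _ /=; apply: (gap_coverP (stp := stp)) => i iM F;
  apply: H1.
  by exists (z - M%:Z + i%:Z) => //; lia.
by exists (z + 1 + i%:Z) => //; lia.
Qed.

End GolfEvents.

(** * Clocks and walks *)

Section NullEvents.
Context {d} {T : measurableType d} {R : realType} (P : probability T R).
Variables (rho p : R) (st clk : int -> T -> R) (stp : int -> nat -> T -> R).
Hypotheses (p01 : 0 <= p <= 1).
Hypothesis law : golf_law P rho rho p st clk stp.

Let X : golf_index -> T -> R := golf_family st clk stp.
Let mX j : measurable_fun setT (X j).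
Proof. by case: law => h _; exact: h. Qed.
Let indX : mutually_independent P X.
Proof. by case: law => _ [_ [_ []]]. Qed.
Let mclk i B : measurable B -> measurable (clk i @^-1` B).
Proof. exact: (measurable_coord mX (inl (inr i))). Qed.

Lemma clocks_lt1 : P.-negligible [set w | ~ forall b, clock_of clk w b < 1].
Proof.
have N : P.-negligible [set w | exists b, (clk b @^-1` (~` [set y | y < 1])) w].
  apply: negligible_exists => b; apply: pr_negligible.
    by apply: mclk; apply: measurableC; exact: measurable_lt_set.
  by rewrite (pr_clk_ge law) ?subrr // ltr01 lexx.
by apply: negligibleS N => w /existsNP[b]; exists b.
Qed.

Lemma pr_clk_itv i x y : 0 <= x <= y -> y <= 1 ->
  pr P (clk i @^-1` `]x, y]%classic) = y - x.
Proof.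
move=> /andP[x0 xy] y1.
have mA z : measurable (clk i @^-1` [set u | u <= z]).
  by apply: mclk; exact: measurable_le_set.
have := prID P (mA y) (mA x).
rewrite (_ : _ `&` _ = clk i @^-1` [set u | u <= x]); last first.
  by apply/seteqP; split=> w /= => [[]//|h]; split=> //; apply: le_trans xy.
rewrite (_ : _ `&` ~` _ = clk i @^-1` `]x, y]%classic); last first.
  apply/seteqP; split=> w /=; rewrite in_itv /=.
    by move=> [h1 /negP]; rewrite -ltNge => ->.
  by move=> /andP[h1 h2]; split => //; apply/negP; rewrite -ltNge.
by rewrite !(pr_clk_le law) ?x0 ?y1 ?(le_trans x0 xy) ?(le_trans xy y1) // => E; rewrite [in RHS]E; ring.
Qed.

Lemma pr_clk_same_itv i j x y : i != j -> 0 <= x <= y -> y <= 1 ->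
  pr P (clk i @^-1` `]x, y]%classic `&` clk j @^-1` `]x, y]%classic) = (y - x) ^+ 2.
Proof.
move=> ij x0 y1; have mI : measurable `]x, y]%classic by exact: measurable_itv.
have [r1 p1] := rect_cons indX (j := inl (inr i)) (rect_nil _) isT mI.
have jN : (inl (inr j) : golf_index) \notin [:: inl (inr i)].
  by rewrite inE; apply/eqP => -[/esym]; apply/eqP.
have [_ ] := rect_cons indX r1 jN mI; rewrite p1 setTI pr_setT mul1r => ->.
by rewrite /X /= !pr_clk_itv // expr2.
Qed.

Let same i j := [set w | clk i w = clk j w].

Let measurable_same i j : measurable (same i j).
Proof.
have m : measurable_fun setT (fun w => clk i w == clk j w).
  apply: measurable_realfun.measurable_fun_eqr.
    exact: (mX (inl (inr i))).
  exact: (mX (inl (inr j))).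
have := m measurableT [set true] I; rewrite setTI; congr measurable.
by apply/seteqP; split=> w /= /eqP.
Qed.

(** Cut [(0, 1]] into [n] cells: equal clocks share a cell, which has probability at most
    [n * (1 / n) ^ 2]. *)
Lemma distinct_clocks : P.-negligible
  [set w | ~ forall b b', clock_of clk w b = clock_of clk w b' -> b = b'].
Proof.
have N i j : i != j -> P.-negligible (same i j).
  move=> ij; have mO : measurable `]0 : R, 1]%classic by exact: measurable_itv.
  have N1 : P.-negligible (clk i @^-1` (~` `]0, 1]%classic)).
    apply: pr_negligible; first by apply: mclk; exact: measurableC.
    by rewrite -preimage_setC prC ?pr_clk_itv ?lexx ?ler01 ?subr0 ?subrr //; exact: mclk.
  suff N2 : P.-negligible (same i j `&` clk i @^-1` `]0, 1]%classic).
    apply: negligibleS (negligibleU N1 N2) => w sw.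
    by have [h|h] := pselect ((clk i @^-1` `]0, 1]%classic) w); [right|left].
  have mS x : measurable (same i j `&` clk i @^-1` `]0 : R, x]%classic).
    by apply: measurableI; [exact: measurable_same|apply: mclk; exact: measurable_itv].
  apply: pr_negligible => //.
  (* Union bound over the first [m] cells, by induction on [m]. *)
  have bound (n m : nat) : (0 < n)%N -> (m <= n)%N ->
      pr P (same i j `&` clk i @^-1` `]0 : R, m%:R / n%:R]%classic) <= m%:R / n%:R ^+ 2.
    move=> n0; have nR : 0 < n%:R :> R by rewrite ltr0n.
    elim: m => [|m IH] mn.
      by rewrite !mul0r set_itvxx preimage_set0 setI0 pr_set0.
    have mn1 : m%:R / n%:R <= m.+1%:R / n%:R :> R by rewrite ler_pM2r ?invr_gt0 // ler_nat.
    have m0 : 0 <= m%:R / n%:R :> R by rewrite divr_ge0.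
    have m1 : m.+1%:R / n%:R <= 1 :> R by rewrite ler_pdivrMr // mul1r ler_nat.
    pose B := clk i @^-1` `](m%:R / n%:R), (m.+1%:R / n%:R)]%classic `&`
              clk j @^-1` `](m%:R / n%:R), (m.+1%:R / n%:R)]%classic.
    have mB : measurable B by apply: measurableI; apply: mclk; exact: measurable_itv.
    apply: (@le_trans _ _ (pr P ((same i j `&` clk i @^-1` `]0, m%:R / n%:R]%classic) `|` B))).
      apply: le_pr => //; first exact: measurableU.
      move=> w [sw] /=; rewrite !in_itv /= => /andP[h1 h2].
      have [h|h] := leP (clk i w) (m%:R / n%:R).
        by left; split; [exact: sw|rewrite /= h1].
      have sw2 : clk i w = clk j w := sw.
      by right; rewrite /B /= -sw2; split; rewrite /= in_itv /=; apply/andP.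
    apply: (le_trans (prU_le P (mS _) mB)).
    rewrite pr_clk_same_itv ?m0 //.
    apply: (le_trans (lerD (IH (ltnW mn)) (lexx _))).
    rewrite le_eqVlt; apply/orP; left; apply/eqP; rewrite -natr1; field.
    by rewrite gt_eqF.
  (* Taking [n = 2 ^ k] turns the bound [1 / n] into a geometric sequence. *)
  apply: (@expr_le0 _ 2^-1); first by apply/andP; split; lra.
  move=> k; have := bound (2 ^ k)%N (2 ^ k)%N; rewrite expn_gt0 leqnn => /(_ isT isT).
  have k0 : (2 ^ k)%:R != 0 :> R by rewrite pnatr_eq0 expn_eq0.
  rewrite divff // => /le_trans; apply; rewrite expr2 invfM mulrA divff // mul1r.
  by rewrite natrX exprVn.
have N2 : P.-negligible [set w | exists i, exists j, (if i == j then set0 else same i j) w].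
  apply: negligible_exists => i; apply: negligible_exists => j.
  by case: eqVneq => [_|/N//]; exact: negligible_set0.
apply: negligibleS N2 => w /existsNP[b] /existsNP[b'] /not_implyP[E nE].
by exists b, b'; case: eqP.
Qed.

Variables (b : int) (c : bool).
(** [step_of] reads every value other than 1 as a step to the left, so the leftward set is a
    complement. *)
Let stepset : set R := if c then [set 1] else ~` [set 1].
Let q := if c then p else 1 - p.

Let mstepset : measurable stepset.
Proof. by rewrite /stepset; case: c => //; exact: measurableC. Qed.

Let stepsetP w k : (step_of stp w b k = c) = stepset (stp b k w).
Proof.
apply/propext; rewrite /step_of /stepset; case: c; split=> /=.
- by move/eqP.
- by move=> ->; rewrite eqxx.
- by move/eqP.
- by move/eqP/negbTE.
Qed.

Let pr_stepset k : pr P (X (inr (b, k)) @^-1` stepset) = q.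
Proof.
have h : pr P (stp b k @^-1` [set 1]) = p.
  by case: law => _ [_ [_ [/(_ b k)[h _] _]]]; rewrite /pr h.
rewrite /X /= /stepset /q; case: c => //.
by rewrite -preimage_setC prC ?h //; exact: (measurable_coord mX (inr (b, k))).
Qed.

Let q01 : 0 <= q <= 1.
Proof. by move: p01; rewrite /q; case: c => // /andP[? ?]; apply/andP; split; lra. Qed.

Definition step_run (m L : nat) : set T :=
  [set w | forall k, (k < L)%N -> step_of stp w b (m + k) = c].

Lemma step_run_rect m L J D : rect X J D -> (forall k, (k < L)%N -> inr (b, m + k)%N \notin J) ->
  exists J', [/\ rect X J' (D `&` step_run m L),
    pr P (D `&` step_run m L) = pr P D * q ^+ L &
    forall j, j \in J' -> j \in J \/ exists2 k, (k < L)%N & j = inr (b, m + k)%N].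
Proof.
move=> rD; elim: L => [|L IH] dJ.
  have -> : step_run m 0 = setT by apply/seteqP; split=> w.
  by exists J; split; rewrite ?setIT ?mulr1 //; left.
have [|J' [rJ' pJ' sub]] := IH; first by move=> k kL; apply: dJ; apply: ltnW.
have -> : step_run m L.+1 = step_run m L `&` X (inr (b, m + L)%N) @^-1` stepset.
  apply/seteqP; split=> w; rewrite /step_run /X /= -stepsetP.
    by move=> h; split=> [k kL|]; apply: h => //; apply: ltnW.
  move=> [h1 h2] k; rewrite ltnS leq_eqVlt => /predU1P[->//|]; exact: h1.
have fresh : inr (b, m + L)%N \notin J'.
  apply/negP => /sub[|[k kL [E]]]; first by rewrite (negbTE (dJ L _)).
  by move: kL; rewrite (_ : k = L) ?ltnn //; move/eqP: E; rewrite eqn_add2l => /eqP ->.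
have [r1 p1] := rect_cons indX rJ' fresh mstepset.
exists (inr (b, m + L)%N :: J'); rewrite setIA; split => //.
  by rewrite p1 pJ' pr_stepset exprSr mulrA.
move=> j; rewrite inE => /predU1P[->|/sub[?|[k kL ->]]]; [by right; exists L|by left|].
by right; exists k => //; apply: ltnW.
Qed.

(** The blocks [[i * L, (i + 1) * L)] are disjoint, so the runs over them are independent. *)
Definition no_step_run (L n : nat) : set T :=
  [set w | forall i, (i < n)%N -> ~ step_run (i * L) L w].

Let no_step_runS L n : no_step_run L n.+1 = no_step_run L n `&` ~` step_run (n * L) L.
Proof.
apply/seteqP; split=> w.
  by move=> h; split=> [i lt|]; apply: h => //; apply: ltnW.
by move=> [h1 h2] i; rewrite ltnS leq_eqVlt => /predU1P[->//|]; exact: h1.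
Qed.

Lemma measurable_step_run m L : measurable (step_run m L).
Proof.
have [//|J' [/(rect_measurable mX)]] := @step_run_rect m L [::] setT (rect_nil _).
by rewrite setTI.
Qed.

Lemma measurable_no_step_run L n : measurable (no_step_run L n).
Proof.
elim: n => [|n IH].
  by rewrite (_ : no_step_run L 0 = setT) //; apply/seteqP; split.
rewrite no_step_runS; apply: measurableI => //.
by apply: measurableC; exact: measurable_step_run.
Qed.

(** The absence of runs is not a product event. Carrying a rectangle [D] along lets the next block
    be handled by subtracting the case where its run occurs. *)
Lemma pr_no_step_run L n J D : rect X J D ->
  (forall k, (k < n * L)%N -> inr (b, k) \notin J) ->
  pr P (no_step_run L n `&` D) = (1 - q ^+ L) ^+ n * pr P D.
Proof.
elim: n J D => [|n IH] J D rD dJ.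
  rewrite (_ : no_step_run L 0 = setT) ?setTI ?mul1r //.
  by apply/seteqP; split.
have fresh k : (k < L)%N -> inr (b, (n * L) + k)%N \notin J.
  by move=> kL; apply: dJ; rewrite mulSn addnC ltn_add2r.
have [J' [r1 p1 sub]] := step_run_rect rD fresh.
have nL k : (k < n * L)%N -> (k < n.+1 * L)%N.
  by move=> kn; apply: leq_trans kn _; rewrite mulSn leq_addl.
have h1 : pr P (no_step_run L n `&` D) = (1 - q ^+ L) ^+ n * pr P D.
  by apply: (IH J) => // k /nL; exact: dJ.
have h2 : pr P (no_step_run L n `&` (D `&` step_run (n * L) L)) =
    (1 - q ^+ L) ^+ n * pr P (D `&` step_run (n * L) L).
  apply: (IH J') => // k kn; apply/negP => /sub[|[k' _ [E]]].
    by rewrite (negbTE (dJ _ (nL _ kn))).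
  by move: kn; rewrite E ltnNge leq_addr.
have mA := measurable_no_step_run L n; have mD := rect_measurable mX rD.
have mB := measurable_step_run (n * L) L.
have := prID P (measurableI _ _ mA mD) mB.
rewrite -(setIA (no_step_run L n)) h2 p1 h1 (_ : _ `&` ~` _ = no_step_run L n.+1 `&` D).
  by move=> E; rewrite exprS; lra.
by rewrite no_step_runS setIAC.
Qed.

Lemma step_run_walk w m L : step_run m L w ->
  walk_pos (step_of stp w) b (m + L) =
  walk_pos (step_of stp w) b m + (if c then L%:Z else - L%:Z).
Proof.
elim: L => [|L IH] h; first by rewrite addn0; case: c; lia.
rewrite addnS walk_posS IH ?h //; first by case: c; lia.
by move=> k kL; apply: h; apply: ltnW.
Qed.

Lemma walk_leaves (L : nat) : 0 < q ->
  P.-negligible [set w | ~ exists n, (L < `|(walk_pos (step_of stp w) b n - b)%R|)%N].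
Proof.
(* A run of [2L + 1] equal steps cannot have both ends within distance [L] of the start, and almost
   surely some block is such a run. *)
move=> q0; pose K := L.*2.+1.
have N : P.-negligible (\bigcap_n no_step_run K n).
  have mI : measurable (\bigcap_n no_step_run K n).
    by apply: bigcapT_measurable => n; exact: measurable_no_step_run.
  have /andP[q1 q2] := q01.
  apply: pr_negligible => //; apply: (@expr_le0 _ (1 - q ^+ K)).
    by rewrite subr_ge0 exprn_ile1 //= ltrBlDr ltrDl exprn_gt0.
  move=> n; have := @pr_no_step_run K n [::] setT (rect_nil _) (fun _ _ => isT).
  rewrite setIT pr_setT mulr1 => <-; apply: le_pr => //.
    exact: measurable_no_step_run.
  by move=> w; apply.
apply: negligibleS N => w nex n _ i _ run; have E := step_run_walk run.
have bound m : (`|(walk_pos (step_of stp w) b m - b)%R| <= L)%N.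
  by rewrite leqNgt; apply/negP => h; apply: nex; exists m.
move: (bound (i * K)%N) (bound (i * K + K)%N); rewrite E /K; case: c; lia.
Qed.

End NullEvents.

Section Unconfined.
Context {d} {T : measurableType d} {R : realType} (P : probability T R).
Variables (rho p : R) (st clk : int -> T -> R) (stp : int -> nat -> T -> R).
Hypotheses (p01 : 0 <= p <= 1).
Hypothesis law : golf_law P rho rho p st clk stp.

Lemma walks_unbounded : P.-negligible [set w | ~ forall b (L : nat),
  exists n, (L < `|(walk_pos (step_of stp w) b n - b)%R|)%N].
Proof.
(* For every [p] at least one direction has positive probability; runs in that direction suffice. *)
have [c q0] : exists c : bool, 0 < (if c then p else 1 - p).
  by have [p0|p0] := ltP 0 p; [exists true|exists false; lra].
have N : P.-negligible [set w | exists b, exists L : nat,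
    ~ exists n, (L < `|(walk_pos (step_of stp w) b n - b)%R|)%N].
  by apply: negligible_exists => b; apply: negligible_exists => L;
    exact: (@walk_leaves _ _ _ P rho p st clk stp p01 law b c L q0).
by apply: negligibleS N => w /existsNP[b] /existsNP[L nex]; exists b, L.
Qed.

End Unconfined.

(** * Measurability and stationarity *)

Section Shift.
Variables (R : realType) (ball hole : int -> Prop) (U : int -> R)
  (step : int -> nat -> bool) (a : int).

Let ball' i := ball (i + a).
Let hole' i := hole (i + a).
Let U' i := U (i + a).
Let step' i k := step (i + a) k.

Lemma walk_pos_shift b n : walk_pos step' b n + a = walk_pos step (b + a) n.
Proof. by rewrite /walk_pos addrAC. Qed.

(** The translated solution is consistent for the translated data, and monotonicity applied both
    ways shows that two consistent evolutions of a finite box fill the same holes. *)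
Lemma box_filled_shift h n t :
  box_filled ball' hole' U' step' h n h t <-> box_filled ball hole U step (h + a) n (h + a) t.
Proof.
pose tau i := box_tau ball hole U step (h + a) n (i + a).
have C := box_tau_consistent ball hole U step (h + a) n.
have Fl x s : filled_before (boxed ball' h n) U' step' tau x s <->
              filled_before (boxed ball (h + a) n) U step (box_tau ball hole U step (h + a) n) (x + a) s.
  split=> -[c [m [[Bc hc] [lt [E w]]]]].
    exists (c + a), m; split; first by split => //; lia.
    by split => //; split => //; rewrite -walk_pos_shift w.
  exists (c - a), m; rewrite /tau /U' subrK; split; first by split; [rewrite /ball' subrK|lia].
  split => //; split => //.
  by apply: (addIr a); rewrite walk_pos_shift subrK.
have Fr x s : free_at (boxed ball' h n) hole' U' step' tau x s <->
    free_at (boxed ball (h + a) n) hole U step (box_tau ball hole U step (h + a) n) (x + a) s.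
  by rewrite /free_at Fl.
have C' : golf_consistent (boxed ball' h n) hole' U' step' tau.
  move=> b; have [C1 C2] := C (b + a); split=> [[bb hb] k|nb].
    apply: (iff_trans (C1 (conj bb _) k)); first by lia.
    rewrite -walk_pos_shift; split=> -[/Fr h1 h2]; split => // m km.
      by move=> /Fr; rewrite walk_pos_shift; apply: h2.
    by rewrite -walk_pos_shift => /Fr; apply: h2.
  by apply: C2 => -[bb hb]; apply: nb; split => //; lia.
apply: iff_trans (Fl h t); split; apply: (filled_mono (hole := hole') (@boxed_mem ball' h n)) => //;
  exact: box_tau_consistent.
Qed.

Lemma never_filled_shift h t :
  never_filled ball' hole' U' step' h t <-> never_filled ball hole U step (h + a) t.
Proof.
by split=> -[hh nf]; split => // n /box_filled_shift; exact: nf.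
Qed.

End Shift.

Section MeasurablePredicates.
Context {d} {T : measurableType d}.

Definition mpred (Q : T -> Prop) : Prop := measurable [set w | Q w].

Lemma mpred_cst (Q : Prop) : mpred (fun=> Q).
Proof.
have [q|nq] := pselect Q.
  by rewrite /mpred (_ : [set _ | Q] = setT) //; apply/seteqP; split.
by rewrite /mpred (_ : [set _ | Q] = set0) //; apply/seteqP; split.
Qed.

Lemma mpred_and Q1 Q2 : mpred Q1 -> mpred Q2 -> mpred (fun w => Q1 w /\ Q2 w).
Proof. exact: measurableI. Qed.

Lemma mpred_or Q1 Q2 : mpred Q1 -> mpred Q2 -> mpred (fun w => Q1 w \/ Q2 w).
Proof. exact: measurableU. Qed.

Lemma mpred_not Q : mpred Q -> mpred (fun w => ~ Q w).
Proof. exact: measurableC. Qed.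

Lemma mpred_iff Q1 Q2 : (forall w, Q1 w <-> Q2 w) -> mpred Q2 -> mpred Q1.
Proof.
by move=> E; rewrite /mpred (_ : [set w | Q1 w] = [set w | Q2 w]) //; apply/seteqP; split=> w /E.
Qed.

Lemma mpred_exists (I : countType) (Q : I -> T -> Prop) :
  (forall i, mpred (Q i)) -> mpred (fun w => exists i, Q i w).
Proof.
move=> mQ; have -> : (fun w => exists i, Q i w) =
    (\bigcup_n (if unpickle n is Some i then [set w | Q i w] else set0)).
  apply/seteqP; split=> w [i]; first by move=> Qi; exists (pickle i) => //; rewrite pickleK.
  by move=> _; case: (unpickle i) => // j; exists j.
by apply: bigcup_measurable => n _; case: unpickle => // i; exact: mQ.
Qed.

Lemma mpred_forall (I : countType) (Q : I -> T -> Prop) :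
  (forall i, mpred (Q i)) -> mpred (fun w => forall i, Q i w).
Proof.
move=> mQ; apply: (mpred_iff (Q2 := fun w => ~ exists i, ~ Q i w)).
  by move=> w; split=> [h [i]|/forallNP h i]; [apply; exact: h|apply: contrapT].
by apply: mpred_not; apply: mpred_exists => i; apply: mpred_not.
Qed.

Lemma mpred_imp (Q0 : Prop) Q : mpred Q -> mpred (fun w => Q0 -> Q w).
Proof.
move=> mQ; have [q|nq] := pselect Q0.
  by apply: mpred_iff mQ => w; split=> [h|h _]; exact: h.
by apply: mpred_iff (mpred_cst True) => w; split.
Qed.

End MeasurablePredicates.

Section ProcessMeasurability.
Context {d} {T : measurableType d} {R : realType}.
Variables (ball hole : T -> int -> Prop) (U : T -> int -> R)
  (step : T -> int -> nat -> bool).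
Hypotheses (mball : forall b, mpred (ball ^~ b)) (mhole : forall b, mpred (hole ^~ b))
  (mU : forall b x, mpred (fun w => U w b <= x))
  (mstep : forall b k, mpred (fun w => step w b k)).

Lemma mpred_clock_lt b t : mpred (fun w => U w b < t).
Proof.
apply: (mpred_iff (Q2 := fun w => exists q : rat, ratr q < t /\ U w b <= ratr q)).
  move=> w; split=> [/rat_in_itvoo[q]|[q [h1 h2]]]; last exact: le_lt_trans h1.
  by rewrite in_itv /= => /andP[/ltW h1 h2]; exists q.
by apply: mpred_exists => q; apply: mpred_and => //; exact: mpred_cst.
Qed.

Lemma mpred_clock_order b b' : mpred (fun w => U w b < U w b').
Proof.
apply: (mpred_iff (Q2 := fun w => exists q : rat, U w b <= ratr q /\ ~ U w b' <= ratr q)).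
  move=> w; split=> [/rat_in_itvoo[q]|[q [h1 /negP]]].
    rewrite in_itv /= => /andP[/ltW h1 h2]; exists q; split => //.
    by apply/negP; rewrite -ltNge.
  by rewrite -ltNge; exact: le_lt_trans.
by apply: mpred_exists => q; apply: mpred_and => //; apply: mpred_not.
Qed.

Lemma mpred_walk b m h : mpred (fun w => walk_pos (step w) b m = h).
Proof.
elim: m h => [|m IH] h.
  by apply: mpred_iff (mpred_cst (b = h)) => w; rewrite walk_pos0.
apply: (mpred_iff (Q2 := fun w => (step w b m /\ walk_pos (step w) b m = h - 1) \/
                                  (~ step w b m /\ walk_pos (step w) b m = h + 1))).
  by move=> w; rewrite walk_posS; case: (step w b m); lia.
by apply: mpred_or; apply: mpred_and => //; apply: mpred_not.
Qed.

Section Next.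
Variables (B : T -> int -> Prop) (tau : T -> int -> option nat).
Hypotheses (mB : forall b, mpred (B ^~ b)) (mtau : forall b n, mpred (fun w => tau w b = Some n)).

Lemma mpred_free b n :
  mpred (fun w => free_at (B w) (hole w) (U w) (step w) (tau w) (walk_pos (step w) b n) (U w b)).
Proof.
apply: mpred_and.
  (* The position of the walk is random; splitting over its countably many values leaves only fixed
     sites. *)
  apply: (mpred_iff (Q2 := fun w => exists h, walk_pos (step w) b n = h /\ hole w h)).
    by move=> w; split=> [hh|[h [<-]]//]; exists (walk_pos (step w) b n).
  by apply: mpred_exists => h; apply: mpred_and => //; exact: mpred_walk.
apply: mpred_not; apply: mpred_exists => c; apply: mpred_exists => m.
apply: mpred_and => //; apply: mpred_and; first exact: mpred_clock_order.
apply: mpred_and => //.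
apply: (mpred_iff (Q2 := fun w => exists h, walk_pos (step w) c m = h /\ walk_pos (step w) b n = h)).
  by move=> w; split=> [E|[h [-> ->]]//]; exists (walk_pos (step w) b n).
by apply: mpred_exists => h; apply: mpred_and; exact: mpred_walk.
Qed.

Lemma mpred_golf_next b n :
  mpred (fun w => golf_next (hole w) (U w) (step w) (B w) (tau w) b = Some n).
Proof.
apply: (mpred_iff (Q2 := fun w => B w b /\
  (free_at (B w) (hole w) (U w) (step w) (tau w) (walk_pos (step w) b n) (U w b) /\
  forall m, (m < n)%N -> ~ free_at (B w) (hole w) (U w) (step w) (tau w) (walk_pos (step w) b m) (U w b)))).
  move=> w; rewrite /golf_next; case: pselect => //= bb; last by split => // -[].
  by split=> [/first_hitP//|[_ h]]; apply/first_hitP.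
apply: mpred_and => //; apply: mpred_and; first exact: mpred_free.
by apply: mpred_forall => m; apply: mpred_imp; apply: mpred_not; exact: mpred_free.
Qed.

End Next.

(** A box evolution is a fixed number of rounds of [golf_next], and each round preserves
    measurability. *)
Lemma mpred_never_filled h t :
  mpred (fun w => never_filled (ball w) (hole w) (U w) (step w) h t).
Proof.
apply: mpred_and => //; apply: mpred_forall => n; apply: mpred_not.
have mB b : mpred (fun w => boxed (ball w) h n b) by apply: mpred_and => //; exact: mpred_cst.
apply: mpred_exists => b; apply: mpred_exists => m.
apply: mpred_and => //; apply: mpred_and; first exact: mpred_clock_lt.
apply: mpred_and; last exact: mpred_walk.
rewrite /box_tau; elim: n.*2.+1 b m => [|k IH] b m; first by apply: mpred_iff (mpred_cst False) => w.
by apply: mpred_golf_next.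
Qed.

End ProcessMeasurability.

(** * Shift invariance of the law of the input *)

Section Stationarity.
Context {d} {T : measurableType d} {R : realType} (P : probability T R).
Variables (rho p : R) (st clk : int -> T -> R) (stp : int -> nat -> T -> R).
Hypothesis law : golf_law P rho rho p st clk stp.

Let X : golf_index -> T -> R := golf_family st clk stp.
Let mX j : measurable_fun setT (X j).
Proof. by case: law => h _; exact: h. Qed.
Let indX : mutually_independent P X.
Proof. by case: law => _ [_ [_ []]]. Qed.

(** The one-coordinate events whose probability the law prescribes, closed under intersection; they
    suffice to express the dynamics. *)
Definition basic_set (j : golf_index) (B : set R) : Prop :=
  [\/ B = setT, B = set0 |
      match j with
      | inl (inl _) => B = [set 1] \/ B = [set 2]
      | inl (inr _) => exists x, B = [set y | y <= x]
      | inr _ => B = [set 1]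
      end].

Lemma basic_set_measurable j B : basic_set j B -> measurable B.
Proof.
move=> [->|->|]//; case: j => [[i [->|->]|i [x ->]]|[i k] ->] //; exact: measurable_le_set.
Qed.

Lemma basic_setI j B1 B2 : basic_set j B1 -> basic_set j B2 -> basic_set j (B1 `&` B2).
Proof.
have n12 := @one_neq_two R.
move=> [->|->|h1]; [by rewrite setTI|by rewrite set0I => _; exact: Or32|].
move=> [->|->|h2]; [by rewrite setIT; exact: Or33|by rewrite setI0; exact: Or32|].
case: j h1 h2 => [[i|i]|[i k]].
- move=> [->|->] [->|->].
  + by rewrite setIid; apply: Or33; left.
  + by apply: Or32; apply/seteqP; split=> w //= [-> /n12].
  + by apply: Or32; apply/seteqP; split=> w //= [-> /esym/n12].
  + by rewrite setIid; apply: Or33; right.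
- move=> [x ->] [y ->]; apply: Or33; exists (Num.min x y); apply/seteqP; split=> w /=.
    by move=> [h1 h2]; rewrite le_min h1 h2.
  by rewrite le_min => /andP.
- by move=> -> ->; rewrite setIid; apply: Or33.
Qed.

Definition shift_index (a : int) (j : golf_index) : golf_index :=
  match j with
  | inl (inl i) => inl (inl (i + a))
  | inl (inr i) => inl (inr (i + a))
  | inr (i, k) => inr (i + a, k)
  end.

Lemma shift_index_inj a : injective (shift_index a).
Proof.
by move=> [[i|i]|[i k]] [[j|j]|[j l]] //= [] => [/addIr->|/addIr->|/addIr-> ->].
Qed.

Lemma pr_basic_shift a j B : basic_set j B ->
  P (X j @^-1` B) = P (X (shift_index a j) @^-1` B).
Proof.
move=> [->|->|]; [by rewrite !preimage_setT|by rewrite !preimage_set0|].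
have [_ [lst [lclk [lstp _]]]] := law.
case: j => [[i|i]|[i k]] /=.
- have [h1 [h2 _]] := lst i; have [h1' [h2' _]] := lst (i + a).
  by move=> [->|->]; rewrite ?[LHS]h1 ?[LHS]h2.
- move=> [x ->]; have mc c : measurable (clk c @^-1` [set y | y <= x]).
    exact: (measurable_coord mX (inl (inr c)) (measurable_le_set x)).
  (* The law covers thresholds in [[0, 1]] only; beyond them, monotonicity from 0 or from 1
     decides. *)
  have [x0|x0] := ltP x 0.
    have Z c : P (clk c @^-1` [set y | y <= x]) = 0%E.
      apply/eqP; rewrite -measure_le0 -[leRHS]/(0%:E) -(lclk c 0) ?lexx ?ler01 //; apply: le_measure; rewrite ?inE //.
        exact: (measurable_coord mX (inl (inr c)) (measurable_le_set 0)).
      by move=> w /= h; apply: le_trans h (ltW x0).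
    by rewrite /X /= !Z.
  have [x1|x1] := leP x 1; first by rewrite /X /= [LHS](lclk i x) ?[RHS](lclk (i + a) x) ?x0.
  have Z c : P (clk c @^-1` [set y | y <= x]) = 1%E.
    apply/eqP; rewrite eq_le probability_le1 //= -[leLHS]/(1%:E) -(lclk c 1) ?lexx ?ler01 //.
    apply: le_measure; rewrite ?inE //.
      exact: (measurable_coord mX (inl (inr c)) (measurable_le_set 1)).
    by move=> w /= h; apply: le_trans h (ltW x1).
  by rewrite /X /= !Z.
- move=> ->; have [h1 _] := lstp i k; have [h2 _] := lstp (i + a) k.
  by rewrite [LHS]h1.
Qed.

(** The sets [B j] are defined for all coordinates and full outside [J], so that intersecting
    cylinders is done coordinatewise. *)
Definition cylinder (E : set (golf_index -> R)) : Prop :=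
  exists J : seq golf_index, exists B : golf_index -> set R,
    [/\ uniq J, forall j, basic_set j (B j), forall j, j \notin J -> B j = setT &
        E = [set z | forall j, B j (z j)]].

Lemma cylinder_setI : setI_closed cylinder.
Proof.
move=> _ _ [J1 [B1 [u1 b1 o1 ->]]] [J2 [B2 [u2 b2 o2 ->]]].
exists (undup (J1 ++ J2)), (fun j => B1 j `&` B2 j); split; first exact: undup_uniq.
- by move=> j; apply: basic_setI.
- by move=> j; rewrite mem_undup mem_cat negb_or => /andP[/o1-> /o2->]; rewrite setIT.
- apply/seteqP; split=> z /=; first by move=> [h1 h2] j.
  by move=> h; split=> j; case: (h j).
Qed.

Definition sample (w : T) : golf_index -> R := X^~ w.
Definition shifted_sample (a : int) (w : T) : golf_index -> R := fun j => X (shift_index a j) w.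

Let stationary (a : int) (E : set (golf_index -> R)) : Prop :=
  [/\ measurable (sample @^-1` E), measurable (shifted_sample a @^-1` E) &
      P (sample @^-1` E) = P (shifted_sample a @^-1` E)].

Lemma cylinder_stationary a : cylinder `<=` stationary a.
Proof.
move=> _ [J [B [uJ bB oJ ->]]].
have mB j : measurable (B j) := basic_set_measurable (bB j).
have E1 : sample @^-1` [set z | forall j, B j (z j)] = \bigcap_(j in [set` J]) (X j @^-1` B j).
  apply/seteqP; split=> w /= h j; first by move=> _; exact: h.
  by have [jJ|/oJ->//] := boolP (j \in J); exact: (h j jJ).
pose B' j := B (shift_index (- a) j).
have cK j : shift_index (- a) (shift_index a j) = j.
  by case: j => [[i|i]|[i k]] /=; rewrite addrK.
have E2 : shifted_sample a @^-1` [set z | forall j, B j (z j)] =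
    \bigcap_(j in [set` map (shift_index a) J]) (X j @^-1` B' j).
  apply/seteqP; split=> w /= h.
    by move=> j /= /mapP[j' _ ->]; rewrite /B' /= cK; exact: h.
  move=> j; have [jJ|/oJ->//] := boolP (j \in J).
  have := h (shift_index a j); rewrite /B' /= cK; apply.
  exact: map_f.
have uJ' : uniq (map (shift_index a) J) by rewrite map_inj_uniq //; exact: shift_index_inj.
have R1 : rect X J (sample @^-1` [set z | forall j, B j (z j)]).
  by split=> //; exists B.
have R2 : rect X (map (shift_index a) J) (shifted_sample a @^-1` [set z | forall j, B j (z j)]).
  by split=> //; exists B' => // j; exact: mB.
split; [exact: (rect_measurable mX R1)|exact: (rect_measurable mX R2)|].
rewrite E1 E2 !indX //; last by move=> j; exact: mB.
rewrite big_map; congr (_%:E); apply: eq_bigr => j _.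
by rewrite /B' cK (pr_basic_shift a (bB j)).
Qed.

Lemma stationary_lambda a : lambda_system setT (stationary a).
Proof.
split=> //.
- by split; rewrite ?preimage_setT.
- move=> A B BA [mA mA' EA] [mB mB' EB].
  have preD (f : T -> golf_index -> R) : f @^-1` (A `\` B) = (f @^-1` A) `\` (f @^-1` B) by [].
  split.
  + by rewrite preD; exact: measurableD.
  + by rewrite preD; exact: measurableD.
  have e (f : T -> golf_index -> R) : measurable (f @^-1` A) -> measurable (f @^-1` B) ->
      P (f @^-1` (A `\` B)) = (P (f @^-1` A) - P (f @^-1` B))%E.
    move=> m1 m2; rewrite preD measureD // ?ltey_eq ?fin_num_measure //.
    by congr (_ - P _)%E; apply: setIidr => w; exact: BA.
  by rewrite !e // EA EB.
- move=> F ndF HF.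
  have m1 n : measurable (sample @^-1` F n) by case: (HF n).
  have m2 n : measurable (shifted_sample a @^-1` F n) by case: (HF n).
  rewrite /stationary !preimage_bigcup; split; [exact: bigcup_measurable|exact: bigcup_measurable|].
  have c1 : P \o (fun n => sample @^-1` F n) @ \oo --> P (\bigcup_n (sample @^-1` F n)).
    apply: nondecreasing_cvg_mu => //; first exact: bigcup_measurable.
    by move=> m n /ndF /subsetPset mn; apply/subsetPset => w; exact: mn.
  have c2 : P \o (fun n => shifted_sample a @^-1` F n) @ \oo -->
            P (\bigcup_n (shifted_sample a @^-1` F n)).
    apply: nondecreasing_cvg_mu => //; first exact: bigcup_measurable.
    by move=> m n /ndF /subsetPset mn; apply/subsetPset => w; exact: mn.
  have Ef : P \o (fun n => sample @^-1` F n) = P \o (fun n => shifted_sample a @^-1` F n).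
    by apply/funext => n /=; case: (HF n).
  by rewrite Ef in c1; exact: (cvg_unique _ c1 c2).
Qed.

(** Dynkin's pi-lambda argument: independence reduces cylinders to one-coordinate probabilities,
    which a shift does not change. *)
Lemma sigma_stationary a E : <<s cylinder >> E -> stationary a E.
Proof.
apply: (lambda_system_subset cylinder_setI (stationary_lambda a) (@cylinder_stationary a)).
by move=> Y _; exact: subsetT.
Qed.

(** Canonical space of inputs. An event measured here pulls back along both [sample] and
    [shifted_sample], which is how stationarity reaches the process. *)
Let Z := g_sigma_algebraType cylinder.
Let cst i (z : Z) : R := z (inl (inl i)).
Let cclk i (z : Z) : R := z (inl (inr i)).
Let cstp i k (z : Z) : R := z (inr (i, k)).

Let mpred_coord (j : golf_index) (B : set R) : basic_set j B ->
  mpred (fun z : Z => B (z j)).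
Proof.
move=> bB; apply: sub_sigma_algebra.
exists [:: j], (fun k => if k == j then B else setT); split=> //.
- by move=> k; case: eqP => [->//|_]; exact: Or31.
- by move=> k; rewrite inE; case: eqP.
apply/seteqP; split=> z /= h; last by have := h j; rewrite eqxx.
by move=> k; case: eqP => [->|].
Qed.

Let mpred_nf h t : mpred (fun z : Z =>
  never_filled (ball_of cst z) (hole_of cst z) (clock_of cclk z) (step_of cstp z) h t).
Proof.
apply: mpred_never_filled.
- by move=> b; apply: (@mpred_coord (inl (inl b)) [set 1]); apply: Or33; left.
- by move=> b; apply: (@mpred_coord (inl (inl b)) [set 2]); apply: Or33; right.
- by move=> b x; apply: (@mpred_coord (inl (inr b)) [set y | y <= x]); apply: Or33; exists x.
- move=> b k; apply: (mpred_iff (Q2 := fun z : Z => [set 1] (z (inr (b, k))))).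
    by move=> z; split=> /eqP.
  by apply: mpred_coord; exact: Or33.
Qed.

Definition never_filled_set (h : int) (t : R) : set T :=
  [set w | never_filled (ball_of st w) (hole_of st w) (clock_of clk w) (step_of stp w) h t].

Lemma measurable_never_filled h t : measurable (never_filled_set h t).
Proof. by case: (@sigma_stationary 0 _ (mpred_nf h t)). Qed.

Lemma pr_never_filled_shift h t : pr P (never_filled_set h t) = pr P (never_filled_set 0 t).
Proof.
have [_ _ E] := @sigma_stationary h _ (mpred_nf 0 t).
rewrite /pr; congr fine; rewrite [RHS]E; congr (P _).
have S w := never_filled_shift (ball_of st w) (hole_of st w) (clock_of clk w) (step_of stp w) h 0 t.
rewrite add0r in S.
by apply/seteqP; split=> w; [exact: (S w).2|exact: (S w).1].
Qed.

End Stationarity.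

(** * Density of the never filled holes *)

(** Linearity of expectation: an almost sure inequality between counts is integrated, with counts
    written as sums of indicators. *)
Lemma sum_pr_le {d} {T : measurableType d} {R : realType} (P : probability T R)
    (I1 I2 : Type) (A : I1 -> set T) (B : I2 -> set T) (s1 : seq I1) (s2 : seq I2) :
  (forall i, measurable (A i)) -> (forall i, measurable (B i)) ->
  P.-negligible [set w | ~ (count (fun i => `[<A i w>]) s1 <= count (fun i => `[<B i w>]) s2)%N] ->
  \sum_(i <- s1) pr P (A i) <= \sum_(i <- s2) pr P (B i).
Proof.
move=> mA mB H.
have mi (J : Type) (C : J -> set T) : (forall i, measurable (C i)) ->
    forall i, measurable_fun setT (EFin \o (\1_(C i) : T -> R)).
  by move=> mC i; apply/measurable_EFinP; exact: measurable_indic.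
have cnt (J : Type) (C : J -> set T) (s : seq J) w :
    (\sum_(i <- s) (\1_(C i) w)%:E)%E = (count (fun i => `[<C i w>]) s)%:R%:E :> \bar R.
  elim: s => [|i s IH]; first by rewrite big_nil.
  by rewrite big_cons IH /= natrD EFinD indicE.
have int (J : Type) (C : J -> set T) (s : seq J) : (forall i, measurable (C i)) ->
    (\int[P]_w (\sum_(i <- s) (\1_(C i) w)%:E))%E = (\sum_(i <- s) pr P (C i))%:E.
  move=> mC; have C0 i w : setT w -> (0 <= (\1_(C i) w)%:E :> \bar R)%E.
    by rewrite lee_fin indicE.
  rewrite (ge0_integral_sum P measurableT (mi _ _ mC) C0).
  rewrite -sumEFin; apply: eq_bigr => i _.
  by rewrite integral_indic // setIT; exact: EFin_pr.
rewrite -lee_fin -!int //; apply: ae_ge0_le_integral => //.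
- by move=> w _; apply: sume_ge0 => i _; rewrite lee_fin indicE.
- by apply: emeasurable_sum => i; exact: (mi _ _ mA i).
- by move=> w _; apply: sume_ge0 => i _; rewrite lee_fin indicE.
- by apply: emeasurable_sum => i; exact: (mi _ _ mB i).
apply: negligibleS H => w /= nH le; apply: nH => _.
by rewrite !cnt lee_fin ler_nat.
Qed.

Section Density.
Context {d} {T : measurableType d} {R : realType} (P : probability T R).
Variables (rho p : R) (st clk : int -> T -> R) (stp : int -> nat -> T -> R).
Hypotheses (rho_gt0 : 0 < rho) (rho_le : rho + rho <= 1) (p01 : 0 <= p <= 1).
Hypothesis law : golf_law P rho rho p st clk stp.

Let rho_ge0 : 0 <= rho := ltW rho_gt0.
Let X : golf_index -> T -> R := golf_family st clk stp.
Let mX j : measurable_fun setT (X j).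
Proof. by case: law => h _; exact: h. Qed.
Let indX : mutually_independent P X.
Proof. by case: law => _ [_ [_ []]]. Qed.

Let active t b := [set w | active_ball st clk t w b].

Let measurable_active t b : measurable (active t b).
Proof.
apply: measurableI; first exact: (measurable_coord mX (inl (inl b)) (measurable_set1 1)).
exact: (measurable_coord mX (inl (inr b)) (measurable_lt_set t)).
Qed.

Let pr_active t b : 0 < t <= 1 -> pr P (active t b) = rho * t.
Proof.
move=> ht.
have [r1 p1] := rect_cons indX (j := inl (inl b)) (rect_nil _) isT (measurable_set1 (1 : R)).
have jN : (inl (inr b) : golf_index) \notin [:: inl (inl b)] by rewrite inE.
have [_ ] := rect_cons indX r1 jN (measurable_lt_set t).
by rewrite p1 setTI pr_setT mul1r /X /= (pr_ball law) (pr_clk_lt law).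
Qed.

Lemma never_filled_density_finite t (k : nat) : 0 < t < 1 -> (2 <= k)%N ->
  pr P (never_filled_set st clk stp 0 t) <=
  rho * (1 - t) + 2 / k%:R + 4 / (1 - decay rho t) ^+ 2 * decay rho t ^+ k.
Proof.
move=> ht k2; have /andP[t0 t1] := ht.
(* The balls near the two ends that are left out cost [2 * k] in a window of length [k ^ 2], which
   gives the error [2 / k]. *)
pose N := (k * k)%N; have kN : (k.*2 <= N)%N by rewrite /N -mul2n leq_mul2r k2 orbT.
pose G := gap_cover st clk t 0 k `|` gap_cover st clk t (N%:Z - k%:Z) k.
have mG : measurable G by apply: measurableU; exact: (measurable_gap_cover law).
have prG : pr P G <= 2 / (1 - decay rho t) ^+ 2 * decay rho t ^+ k.
  apply: le_trans (prU_le _ _ _) _; try exact: (measurable_gap_cover law).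
  have h c := pr_gap_cover law rho_ge0 rho_le rho_gt0 c k ht.
  apply: (le_trans (lerD (h _) (h _))).
  by rewrite le_eqVlt; apply/orP; left; apply/eqP; ring.
pose A (i : int + int) := match i with inl x => never_filled_set st clk stp x t | inr x => active t x end.
(* On [G] a barrier near an end may be missing, but the left-hand count never exceeds [2 * N];
   listing [G] that often on the right pays for it. *)
pose B (i : int + unit) := match i with inl x => st x @^-1` [set 2] | inr _ => G end.
have := @sum_pr_le _ _ _ P _ _ A B (map inl (zrange 0 N) ++ map inr (zrange k (N - k.*2)))
  (map inl (zrange 0 N) ++ nseq N.*2 (inr tt)).
rewrite !big_cat !big_map /=.
have -> : \sum_(j <- iota 0 N) pr P (never_filled_set st clk stp (0 + j%:Z) t) =
    N%:R * pr P (never_filled_set st clk stp 0 t).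
  rewrite (eq_bigr (fun=> pr P (never_filled_set st clk stp 0 t))).
    by rewrite big_const_seq count_predT size_iota iter_addr_0 mulr_natl.
  by move=> x _; exact: (pr_never_filled_shift law).
have -> : \sum_(j <- iota 0 (N - k.*2)) pr P (active t (k%:Z + j%:Z)) = (N - k.*2)%:R * (rho * t).
  rewrite (eq_bigr (fun=> rho * t)).
    by rewrite big_const_seq count_predT size_iota iter_addr_0 mulr_natl.
  by move=> x _; rewrite pr_active // t0 ltW.
have -> : \sum_(j <- iota 0 N) pr P (st (0 + j%:Z) @^-1` [set 2]) = N%:R * rho.
  rewrite (eq_bigr (fun=> rho)).
    by rewrite big_const_seq count_predT size_iota iter_addr_0 mulr_natl.
  by move=> x _; exact: (pr_hole law).
have -> : \sum_(i <- nseq N.*2 (inr tt : int + unit)) pr P (B i) = N.*2%:R * pr P G.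
  by rewrite big_nseq iter_addr_0 mulr_natl.
move=> H.
have {H} : N%:R * pr P (never_filled_set st clk stp 0 t) + (N - k.*2)%:R * (rho * t) <=
    N%:R * rho + N.*2%:R * pr P G.
  apply: H.
  - by move=> [x|x]; [exact: (measurable_never_filled law)|exact: measurable_active].
  - by move=> [x|x] //; exact: (measurable_coord mX (inl (inl x)) (measurable_set1 2)).
  apply: negligibleS (negligibleU (distinct_clocks law) (walks_unbounded p01 law)) => w nle.
  apply: contrapT => /not_orP[/contrapT inj /contrapT unb]; apply: nle.
  rewrite !count_cat !count_map count_nseq /=.
  have [Gw|nG] := pselect (G w).
    rewrite (asboolT Gw) mul1n; apply: (@leq_trans (N + N)); last by rewrite addnn leq_addl.
    apply: leq_add; first by apply: leq_trans (count_size _ _) _; rewrite size_iota.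
    by apply: leq_trans (count_size _ _) _; rewrite size_iota leq_subr.
  apply: leq_trans (leq_addr _ _).
  have /not_orP[g1 g2] := nG.
  have [i [ik Fi]] : exists i, (i < k)%N /\ never_filled_set st clk stp (0 + i%:Z) t w.
    apply: contrapT => ne; apply: g1; apply: (gap_coverP (stp := stp)) => i ik F; apply: ne.
    by exists i.
  have [j [jk Fj]] : exists j, (j < k)%N /\ never_filled_set st clk stp (N%:Z - k%:Z + j%:Z) t w.
    apply: contrapT => ne; apply: g2; apply: (gap_coverP (stp := stp)) => j jk F; apply: ne.
    by exists j.
  have := never_filled_balance (N := N) (k := k) (fun b b' _ _ => inj b b') unb Fi _ Fj _.
  rewrite /zcount /zrange !count_map; apply; lia.
have k0 : 0 < k%:R :> R by rewrite ltr0n; lia.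
have N0 : 0 < N%:R :> R by rewrite /N natrM mulr_gt0.
have NE : N%:R = k%:R ^+ 2 :> R by rewrite /N natrM expr2.
clearbody N.
rewrite natrB // -!mul2n !natrM => H.
have rt1 : rho * t <= 1.
  by apply: (@le_trans _ _ rho); [apply: ler_piMr; rewrite ?ltW|move: rho_ge0 rho_le; lra].
have rt0 : 0 <= rho * t by rewrite mulr_ge0 // ltW.
rewrite -(ler_pM2l N0) (le_trans (_ : _ <= N%:R * rho - N%:R * (rho * t) + 2 * k%:R * (rho * t) + 2 * N%:R * pr P G)) //.
  by lra.
have E : N%:R * (2 / k%:R) = 2 * k%:R :> R by rewrite NE; field; rewrite gt_eqF.
rewrite !mulrDr E.
have h1 : 2 * k%:R * (rho * t) <= 2 * k%:R by apply: ler_piMr => //; rewrite mulr_ge0 // ltW.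
have h2 := ler_wpM2l (mulr_ge0 (ler0n R 2) (ltW N0)) prG.
lra.
Qed.

Lemma never_filled_density t : 0 < t < 1 ->
  pr P (never_filled_set st clk stp 0 t) <= rho * (1 - t).
Proof.
move=> ht; have /andP[r0 r1] := decay_lt1 rho_ge0 rho_le rho_gt0 ht.
pose K := 4 / (1 - decay rho t) ^+ 2.
have K0 : 0 <= K by rewrite /K divr_ge0 // exprn_ge0 // subr_ge0 ltW.
have c : (fun n => rho * (1 - t) + 2 * @harmonic R n + K * decay rho t ^+ n) @ \oo -->
    rho * (1 - t) + 2 * 0 + K * 0.
  apply: cvgD; last by apply: cvgMr; apply: cvg_expr; rewrite ger0_norm.
  by apply: cvgD; [exact: cvg_cst|apply: cvgMr; exact: cvg_harmonic].
rewrite !mulr0 !addr0 in c.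
apply: (ler_cvg_to (cvg_cst _) c); apply: nearW => n.
(* The index [n.+2] meets the requirement [2 <= k], and [2 / (n + 2)] is below twice the harmonic
   term. *)
apply: (le_trans (never_filled_density_finite ht (isT : (2 <= n.+2)%N))).
apply: lerD; [apply: lerD => //|apply: ler_wpM2l => //].
  by rewrite ler_wpM2l // /harmonic lef_pV2 ?posrE ?ltr0n // ler_nat.
by apply: ler_wiXn2l => //; [exact: ltW|rewrite -addn2 leq_addr].
Qed.

(** A countable family of times tending to 1, so exceptional sets can be united; the densities at
    these times decay geometrically. *)
Definition near_one (n : nat) : R := 1 - 2^-1 ^+ n.+1.

Lemma near_one01 n : 0 < near_one n < 1.
Proof.
have h : (2^-1 : R) ^+ n.+1 <= 2^-1.
  by rewrite exprS ler_piMr ?invr_ge0 ?exprn_ile1 ?invr_le1 ?unitfE //; lra.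
have h0 : 0 < (2^-1 : R) ^+ n.+1 by rewrite exprn_gt0 // invr_gt0.
by rewrite /near_one; apply/andP; split; lra.
Qed.

Lemma near_one_ge s : s < 1 -> exists n, s <= near_one n.
Proof.
move=> s1; apply: contrapT => ne; have : 1 - s <= 0; last by lra.
apply: (@expr_le0 _ 2^-1); first by apply/andP; split; lra.
move=> n; have [h|h] := leP s (near_one n); first by exfalso; apply: ne; exists n.
move: h; rewrite /near_one exprS.
have : 0 <= (2^-1 : R) ^+ n by rewrite exprn_ge0 // invr_ge0.
lra.
Qed.

Lemma eventually_filled : P.-negligible
  [set w | exists h, forall n, never_filled_set st clk stp h (near_one n) w].
Proof.
apply: negligible_exists => h.
have mS : measurable (\bigcap_n never_filled_set st clk stp h (near_one n)).
  by apply: bigcapT_measurable => n; exact: (measurable_never_filled law).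
have N : P.-negligible (\bigcap_n never_filled_set st clk stp h (near_one n)).
  apply: pr_negligible => //; apply: (@expr_le0 _ 2^-1); first by apply/andP; split; lra.
  move=> n; apply: (@le_trans _ _ (pr P (never_filled_set st clk stp h (near_one n)))).
    by apply: le_pr => //; [exact: (measurable_never_filled law)|move=> w; apply].
  rewrite (pr_never_filled_shift law); apply: le_trans (never_filled_density (near_one01 n)) _.
  rewrite /near_one exprS; have : 0 <= (2^-1 : R) ^+ n by rewrite exprn_ge0 // invr_ge0.
  by move: rho_gt0 rho_le; nra.
by apply: negligibleS N => w H n _; exact: H.
Qed.

Lemma golf_consistent_no_free_hole : P.-negligible [set w | ~
  ((exists tau, golf_consistent (ball_of st w) (hole_of st w) (clock_of clk w) (step_of stp w) tau) /\
   (forall tau, golf_consistent (ball_of st w) (hole_of st w) (clock_of clk w) (step_of stp w) tau ->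
      forall h, ~ free_at_time1 (ball_of st w) (hole_of st w) (clock_of clk w) (step_of stp w) tau h))].
Proof.
have N1 := negligible_exists (fun n => never_filled_unbounded law rho_ge0 rho_le rho_gt0 (near_one01 n)).
apply: negligibleS (negligibleU (clocks_lt1 law) (negligibleU eventually_filled N1)) => w nQ.
apply: contrapT => /not_orP[/contrapT U1 /not_orP[nh nn]]; apply: nQ; split.
  apply: golf_consistent_exists => // s s1 z; have [n sn] := near_one_ge s1.
  have [[x xz Fx] [y zy Fy]] : (exists2 x : int, x < z & never_filled_set st clk stp x (near_one n) w) /\
      (exists2 y : int, z < y & never_filled_set st clk stp y (near_one n) w).
    by apply: contrapT => H; apply: nn; exists n => H'; exact: H (H' z).
  split; [exists x => //|exists y => //].
    exact: never_filled_anti Fx.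
  exact: never_filled_anti Fy.
(* Box fillings lie below this [tau], so a hole it leaves free at time 1 is never filled at any
   [near_one n]. *)
move=> tau C h [hh nf]; apply: nh; exists h => n; split => // m.
move=> /(box_filled_consistent C)[b [k [bb [lt [E Ew]]]]]; apply: nf.
by exists b, k; split => //; split; [apply: ltW; exact: U1|split].
Qed.

End Density.

Theorem mainTheorem7 (R : realType) (d : measure_display) (T : measurableType d)
    (P : probability T R) (rho_b rho_h p : R)
    (st clk : int -> T -> R) (stp : int -> nat -> T -> R) :
  0 <= rho_b -> 0 <= rho_h -> rho_b + rho_h <= 1 -> rho_b = rho_h ->
  0 <= p <= 1 ->
  golf_law P rho_b rho_h p st clk stp ->
  {ae P, forall w,
    (exists tau, golf_consistent (ball_of st w) (hole_of st w) (clock_of clk w)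
                   (step_of stp w) tau) /\
    (forall tau, golf_consistent (ball_of st w) (hole_of st w) (clock_of clk w)
                   (step_of stp w) tau ->
       forall h, ~ free_at_time1 (ball_of st w) (hole_of st w) (clock_of clk w)
                   (step_of stp w) tau h)}.
Proof.
move=> r0 _ r1 E; rewrite -{}E in r1 * => p01 law; move: r0; rewrite le_eqVlt => /predU1P[E|r0].
  (* For zero density [decay] equals 1 and the deviation bound says nothing; but then almost surely
     there are neither balls nor holes, and the empty evolution serves. *)
  have m i (x : R) : measurable (st i @^-1` [set x]).
    by case: law => mX _; exact: (measurable_coord mX (inl (inl i)) (measurable_set1 x)).
  have N1 : P.-negligible [set w | exists i, (st i @^-1` [set 1]) w].
    by apply: negligible_exists => i; apply: pr_negligible => //; rewrite (pr_ball law) -E.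
  have N2 : P.-negligible [set w | exists i, (st i @^-1` [set 2]) w].
    by apply: negligible_exists => i; apply: pr_negligible => //; rewrite (pr_hole law) -E.
  apply: negligibleS (negligibleU N1 N2) => w nQ; apply: contrapT => /not_orP[nb nh]; apply: nQ.
  split=> [|tau _ h [hh _]]; last by apply: nh; exists h.
  by exists (fun=> None) => b; split=> // bb; exfalso; apply: nb; exists b.
exact: (golf_consistent_no_free_hole r0 r1 p01 law).
Qed.
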